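(* Let $\alpha^*\in\ell^p_\beta$ be a scaled KKT point, with multiplier $\nu$, of the problem $$\min_{\alpha\in\ell^p_\beta}\ \|\alpha\|_{2,p}^p\quad\text{s.t.}\quad \alpha^HY\alpha-2\mathrm{Re}(\alpha^H\alpha^\circ)+c\le\varrho .$$ Then there exists $\tilde c>0$ with $\|Y\alpha^*-\alpha^\circ\|\le\tilde c$, and for every $l\in\mathbb N_0$ with $\alpha^*_{l\cdot}\neq 0$ one has $\nu>0$ and $$\|\alpha^*_{l\cdot}\|\ \ge\ \left(\frac{p\beta_l}{2\nu\tilde c}\right)^{\frac1{1-p}} .$$ Consequently the set $\{l\in\mathbb N_0:\|\alpha^*_{l\cdot}\|\ne0\}$ is finite.
   Context: Fix $0<p<1$ and $\eta>1$; put $\beta_0=1$ and $\beta_l=\eta^l l^p$ for $l\ge1$. Let $\mathbb N_0=\{0,1,2,\dots\}$. $\mathbb S^2\subset\mathbb R^3$ is the unit sphere with surface measure $\sigma$, $\sigma(\mathbb S^2)=4\pi$; $Y_{l,m}$ ($l\in\mathbb N_0$, $-l\le m\le l$) are the complex spherical harmonics of degree $l$ and order $m$, forming an orthonormal basis of $L_2(\mathbb S^2)$. $\Gamma\subset\mathbb S^2$ is a measurable set containing a nonempty open subset of $\mathbb S^2$, with $\mathbb S^2\setminus\Gamma$ nonempty. $T^\circ\in L_2(\mathbb S^2)$ is real-valued, $c=\int_{\mathbb S^2}|T^\circ|^2d\sigma$, and $\varrho$ is a real number with $\int_{\mathbb S^2\setminus\Gamma}|T^\circ|^2d\sigma<\varrho<c$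 (so $\alpha=0$ is not feasible). Infinite coefficient vectors are grouped by degree: $\alpha=(\alpha_{0\cdot}^T,\alpha_{1\cdot}^T,\dots)^T$ with $\alpha_{l\cdot}=(\alpha_{l,-l},\dots,\alpha_{l,l})^T\in\mathbb C^{2l+1}$; $\|\cdot\|$ is the $\ell_2$ norm; $\alpha\in\ell^2$ means $\sum_l\|\alpha_{l\cdot}\|^2<\infty$. Put $\|\alpha\|_{2,p}^p=\sum_{l\ge0}\beta_l\|\alpha_{l\cdot}\|^p$ and $\ell^p_\beta=\{\alpha\in\ell^2:\|\alpha\|_{2,p}^p<\infty\}$. $Y$ is the infinite matrix whose entry in row $(l,m)$ and column $(l',m')$ is $\int_\Gamma\overline{Y_{l,m}}\,Y_{l',m'}\,d\sigma$, $Y_{l\cdot}$ denotes the block of rows of degree $l$, and $\alpha^\circ$ has entries $\alpha^\circ_{l,m}=\int_\Gamma T^\circ\,\overline{Y_{l,m}}\,d\sigma$. $\alpha^*\in\ell^p_\beta$ is a scaled KKT point with multiplier $\nu\in\mathbb R$ if: $p\beta_l\|\alpha^*_{l\cdot}\|^p\alpha^*_{l\cdot}+2\nu\|\alpha^*_{l\cdot}\|^2(Y_{l\cdot}\alpha^*-\alpha^\circ_{l\cdot})=0$ for all $l\in\mathbb N_0$; $\nu\big((\alpha^* )^HY\alpha^*-2\mathrm{Re}((\alpha^* )^H\alpha^\circ)+c-\varrho\big)=0$; $(\alpha^* )^HY\alpha^*-2\mathrm{Re}((\alpha^* )^H\alpha^\circ)+c\le\varrho$; and $\nu\ge0$. 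*)

(* Defs.v *)
From HB Require Import structures.
From mathcomp Require Import all_boot all_order all_algebra.
From mathcomp Require Import complex.
From mathcomp Require Import all_classical all_reals all_analysis.
From mathcomp Require Import measurable_realfun.

Set Implicit Arguments.
Unset Strict Implicit.
Unset Printing Implicit Defensive.

Import Order.TTheory GRing.Theory Num.Theory.
Import numFieldNormedType.Exports.

Local Open Scope classical_set_scope.
Local Open Scope ring_scope.

(* The sphere is a subset of R * R * R (product topology and product, i.e.
   Borel, sigma-algebra); its surface measure is a measure on the whole of
   R * R * R that is concentrated on the sphere. *)

Section Sphere.
Variable R : realType.

Definition sphere : set (R * R * R) :=
  [set x | x.1.1 ^+ 2 + x.1.2 ^+ 2 + x.2 ^+ 2 = 1].

(* u = (theta, phi): colatitude and longitude *)
Definition spherical_coord (u : R * R) : R * R * R :=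
  (sin u.1 * cos u.2, sin u.1 * sin u.2, cos u.1).

Definition angle_box : set (R * R) :=
  `[0, pi]%classic `*` `[0, 2 * pi]%classic.

Let leb2 := (@lebesgue_measure R \x @lebesgue_measure R)%E.

(* surface element: sin theta dtheta dphi *)
Definition surface_measure (A : set (R * R * R)) : \bar R :=
  (\int[leb2]_(u in angle_box `&` spherical_coord @^-1` A) (sin u.1)%:E)%E.

Lemma measurable_angle_box : measurable angle_box.
Proof. by apply: measurableX; exact: measurable_itv. Qed.

Lemma measurable_spherical_coord : measurable_fun setT spherical_coord.
Proof.
have msin : measurable_fun setT (@sin R).
  by apply: continuous_measurable_fun; exact: continuous_sin.
have mcos : measurable_fun setT (@cos R).
  by apply: continuous_measurable_fun; exact: continuous_cos.
apply: measurable_fun_pair; last exact: measurableT_comp.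
by apply: measurable_fun_pair; apply: measurable_funM; exact: measurableT_comp.
Qed.

Lemma angle_box_sin_ge0 u : angle_box u -> 0 <= sin u.1.
Proof. by move=> [] /=; rewrite in_itv /= => /sin_ge0_pi. Qed.

Let surface_measure0 : surface_measure set0 = 0%E.
Proof. by rewrite /surface_measure preimage_set0 setI0 integral_set0. Qed.

Let surface_measure_ge0 A : (0 <= surface_measure A)%E.
Proof.
by apply: integral_ge0 => u [+ _] => /angle_box_sin_ge0; rewrite lee_fin.
Qed.

Let surface_measure_sigma_additive : semi_sigma_additive surface_measure.
Proof.
move=> /= F mF tF mUF.
have mF' k : measurable (angle_box `&` spherical_coord @^-1` F k).
  apply: measurableI; first exact: measurable_angle_box.
  by rewrite -[_ @^-1` _]setTI; exact: measurable_spherical_coord.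
rewrite /surface_measure; apply: cvg_toP.
  apply: ereal_nondecreasing_is_cvgn => m n mn.
  by apply: lee_sum_nneg_natr => // k _ _; exact: surface_measure_ge0.
rewrite preimage_bigcup setI_bigcupr ge0_integral_bigcup//=.
- apply/measurable_funTS/measurableT_comp => //=.
  apply: measurableT_comp => //.
  by apply: continuous_measurable_fun; exact: continuous_sin.
- by move=> u [k _ [+ _]] => /angle_box_sin_ge0; rewrite lee_fin.
- apply/trivIsetP => i j _ _ ij.
  rewrite setIACA setIid -preimage_setI.
  by move/trivIsetP : tF => ->//; rewrite preimage_set0 setI0.
Qed.

HB.instance Definition _ := isMeasure.Build _ _ _ surface_measure
  surface_measure0 surface_measure_ge0 surface_measure_sigma_additive.

(* integral of a complex-valued function, component by component *)
Definition cintegral (D : set (R * R * R)) (f : R * R * R -> R[i]) : R[i] :=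
  Complex (\int[surface_measure]_(x in D) complex.Re (f x))
          (\int[surface_measure]_(x in D) complex.Im (f x)).

End Sphere.

Arguments sphere R : clear implicits.
Arguments angle_box R : clear implicits.
Arguments surface_measure R : clear implicits.

Section SphericalHarmonics.
Variable R : realType.

(* Rodrigues' formula *)
Definition legendre (l : nat) : {poly R} :=
  ((2 ^+ l * l`!%:R)^-1) *: (('X^2 - 1) ^+ l)^`(l).

(* For 0 <= m <= l, Y_{l,m} = N_{l,m} P_l^m(cos theta) e^{i m phi}, where
   P_l^m(t) = (-1)^m (1 - t^2)^(m/2) (d/dt)^m P_l(t) is the associated Legendre
   function. At the point (x, y, z) of the sphere, z = cos theta and
   (sin theta)^m e^{i m phi} = (x + i y)^m. *)
Definition sph_harm_nneg (l m : nat) (x : R * R * R) : R[i] :=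
  (real_complex R (Num.sqrt ((l.*2.+1)%:R / (4 * pi)
                             * ((l - m)`!%:R / (l + m)`!%:R))))
  * (-1) ^+ m * (Complex x.1.1 x.1.2) ^+ m
  * real_complex R ((legendre l)^`(m)).[x.2].

(* Y_{l,-m} = (-1)^m conj(Y_{l,m}) *)
Definition sph_harm (l : nat) (m : int) (x : R * R * R) : R[i] :=
  match m with
  | Posz k => sph_harm_nneg l k x
  | Negz k => (-1) ^+ k.+1 * (sph_harm_nneg l k.+1 x)^*%C
  end.

End SphericalHarmonics.

Section Coefficients.
Variable R : realType.

(* The entry (l, m), -l <= m <= l, of an infinite vector v grouped by degree is
   v l i 0 with i = m + l, i.e. m = harm_order i. *)
Definition coeffs : Type := forall l : nat, 'cV[R[i]]_(l.*2.+1).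

Definition harm_order (l : nat) (i : 'I_(l.*2.+1)) : int := (i : nat)%:Z - l%:Z.

(* Euclidean norm (the norm that matrices carry in the library is the maximum
   of the moduli of the entries) *)
Definition norm2 (n : nat) (v : 'cV[R[i]]_n) : R :=
  Num.sqrt (\sum_i Normc.normc (v i 0) ^+ 2).

Definition l2norm (v : coeffs) : \bar R :=
  ((\sum_(0 <= l <oo) (norm2 (v l) ^+ 2)%:E) `^ (2^-1))%E.

(* sum of a complex series *)
Definition cseries (u : nat -> R[i]) : R[i] :=
  Complex (limn (series (fun n => complex.Re (u n))))
          (limn (series (fun n => complex.Im (u n)))).

(* u^H v *)
Definition hdot (u v : coeffs) : R[i] :=
  cseries (fun l => \sum_i (u l i 0)^*%C * v l i 0).

Section Problem.
Variables (p eta : R) (Gamma : set (R * R * R)) (T0 : R * R * R -> R).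

Definition beta (l : nat) : R :=
  if l == 0%N then 1 else eta ^+ l * (l%:R `^ p).

Definition in_lpbeta (a : coeffs) : Prop :=
  (l2norm a < +oo)%E /\
  (\sum_(0 <= l <oo) (beta l * norm2 (a l) `^ p)%:E < +oo)%E.

(* block of Y with rows of degree l and columns of degree l' *)
Definition Yblock (l l' : nat) : 'M[R[i]]_(l.*2.+1, l'.*2.+1) :=
  \matrix_(i, j) cintegral Gamma
    (fun x => (sph_harm l (harm_order i) x)^*%C * sph_harm l' (harm_order j) x).

(* Y a; as the rows of Y are square summable (Bessel), the series defining the
   entries converge for every a in l^2 *)
Definition Ymul (a : coeffs) : coeffs := fun l =>
  \col_i cseries (fun l' => (Yblock l l' *m a l') i 0).

Definition alpha0 : coeffs := fun l =>
  \col_i cintegral Gamma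
    (fun x => real_complex R (T0 x) * (sph_harm l (harm_order i) x)^*%C).

Definition residual (a : coeffs) : coeffs := fun l => Ymul a l - alpha0 l.

(* int_D |T0|^2 dsigma *)
Definition energy (D : set (R * R * R)) : R :=
  \int[surface_measure R]_(x in D) (T0 x ^+ 2).

(* a^H Y a - 2 Re(a^H alpha0) + c; the number a^H Y a is real because Y is
   Hermitian *)
Definition misfit (a : coeffs) : R :=
  complex.Re (hdot a (Ymul a)) - 2 * complex.Re (hdot a alpha0) + energy (sphere R).

Record scaled_KKT (rho : R) (a : coeffs) (nu : R) : Prop := ScaledKKT {
  kkt_stationary : forall l,
    real_complex R (p * beta l * norm2 (a l) `^ p) *: a l
    + real_complex R (2 * nu * norm2 (a l) ^+ 2) *: residual a l = 0;
  kkt_complementary : nu * (misfit a - rho) = 0;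
  kkt_feasible : misfit a <= rho;
  kkt_multiplier : 0 <= nu
}.

End Problem.
End Coefficients.

(* Main.v *)
(* The spherical harmonics are orthonormal on the sphere: in spherical
   coordinates the longitude separates the orders, and for a fixed order
   Rodrigues' formula and integration by parts separate the degrees. Hence, by
   Bessel's inequality, [alpha0] is square summable (it lists the coefficients
   of the restriction of [T0] to [Gamma]), and so is [Y a], because the
   truncations of [Y a] list the coefficients of the restrictions to [Gamma] of
   the partial expansions of [a]. So the residual has a finite norm [ctilde].
   Taking norms in the stationarity condition of a nonzero block, with
   [x = norm2 (a l)], gives [p beta_l x^(p+1) <= 2 nu x^2 ctilde], i.e. the lower
   bound. As [beta_l >= 1], the nonzero blocks are bounded away from 0, and a
   square summable sequence has only finitely many such terms. *)

Require Import Defs.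
From mathcomp Require Import all_boot all_order all_algebra.
From mathcomp Require Import complex.
From mathcomp Require Import all_classical all_reals all_analysis.
From mathcomp Require Import measurable_realfun.
From mathcomp Require Import ring lra zify.
Set Implicit Arguments.
Unset Strict Implicit.
Unset Printing Implicit Defensive.

Import Order.TTheory GRing.Theory Num.Theory.
Import numFieldNormedType.Exports.
Local Open Scope classical_set_scope.
Local Open Scope ring_scope.

(** * Orthogonality of the associated Legendre functions *)

Section PolynomialIntegral.
Variable R : realType.
Implicit Types (p q f g : {poly R}).

(* [poly_int p] is the integral of [p] over [-1, 1], computed from a formal
   primitive so that integration by parts is polynomial algebra. *)
Definition poly_prim p : {poly R} :=
  \poly_(i < (size p).+1) (p`_i.-1 / i%:R).

(** No bound on [i] is needed. At [i = 0] the convention that the inverse of 0 is 0 gives constant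
    coefficient 0, and past the truncation the coefficient of [p] is itself 0. *)
Lemma coef_poly_prim p i : (poly_prim p)`_i = p`_i.-1 / i%:R.
Proof.
rewrite coef_poly; case: ltnP => // pi; rewrite nth_default ?mul0r//.
by case: i pi.
Qed.

Lemma deriv_poly_prim p : (poly_prim p)^`() = p.
Proof.
apply/polyP => i; rewrite coef_deriv coef_poly_prim /= -[LHS]mulr_natr divfK//.
Qed.

Definition poly_int p : R := (poly_prim p).[1] - (poly_prim p).[-1].

Lemma poly_intD : {morph poly_int : p q / p + q}.
Proof.
move=> p q; rewrite /poly_int.
have -> : poly_prim (p + q) = poly_prim p + poly_prim q.
  by apply/polyP => i; rewrite coefD !coef_poly_prim coefD mulrDl.
by rewrite !hornerD; ring.
Qed.

Lemma poly_intZ c p : poly_int (c *: p) = c * poly_int p.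
Proof.
rewrite /poly_int.
have -> : poly_prim (c *: p) = c *: poly_prim p.
  by apply/polyP => i; rewrite coefZ !coef_poly_prim coefZ mulrA.
by rewrite !hornerZ; ring.
Qed.

Lemma poly_int_deriv q : poly_int q^`() = q.[1] - q.[-1].
Proof.
(* The formal primitive of the derivative recovers [q] up to its constant term, which cancels
   between the two endpoints. *)
have -> : q = poly_prim q^`() + (q`_0)%:P.
  apply/polyP => -[|i]; rewrite coefD coef_poly_prim coefC /=.
    by rewrite invr0 mulr0 add0r.
  by rewrite addr0 coef_deriv -[X in X / _]mulr_natr mulfK// pnatr_eq0.
by rewrite derivD derivC addr0 deriv_poly_prim /poly_int !hornerE; ring.
Qed.

Lemma poly_int_parts f g : f.[1] = 0 -> f.[-1] = 0 ->
  poly_int (g * f^`()) = - poly_int (g^`() * f).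
Proof.
move=> f1 fN1; have := poly_int_deriv (g * f).
rewrite derivM poly_intD !hornerM f1 fN1 !mulr0 subrr => /eqP.
by rewrite addrC addr_eq0 => /eqP.
Qed.

Lemma poly_int_partsn n f g :
    (forall k, (k < n)%N -> f^`(k).[1] = 0 /\ f^`(k).[-1] = 0) ->
  poly_int (g * f^`(n)) = (-1) ^+ n * poly_int (g^`(n) * f).
Proof.
elim: n g => [|n IH] g fn; first by rewrite !derivn0 expr0 mul1r.
have [f1 fN1] := fn n (ltnSn n).
rewrite derivnS poly_int_parts// IH => [|k kn]; last exact/fn/ltnW.
by rewrite -derivSn exprS mulN1r mulNr.
Qed.

Let w : {poly R} := 'X^2 - 1.

(** Each derivative costs at most one factor [w], so a positive power of [w], which vanishes at 1
    and -1, still divides the result. This removes all boundary terms in the repeated integrations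
    by parts. *)
Lemma horner_derivn_vanish n r k : (k < n)%N ->
  ((r * w ^+ n)^`(k)).[1] = 0 /\ ((r * w ^+ n)^`(k)).[-1] = 0.
Proof.
move=> kn; suff [q ->] : exists q, (r * w ^+ n)^`(k) = q * w ^+ (n - k).
  rewrite -(subnSK kn) exprSr mulrA !hornerM.
  by rewrite /w !hornerE sqrrN !expr1n subrr !mulr0.
elim: k kn => [|k IH] kn; first by exists r; rewrite subn0.
have [q qE] := IH (ltnW kn); rewrite derivnS qE.
(* The product rule applied to [q * w ^+ (n - k)], with [w ^+ (n - k).-1] factored out. *)
exists (q^`() * w + q * (w^`() *+ (n - k))); rewrite derivM deriv_exp.
rewrite -(subnSK (ltnW kn)) /= exprS; move: (_ - _)%N => j.
rewrite [RHS]mulrDl -[in RHS]mulrA -[in RHS]mulrA.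
by congr (_ + _); rewrite !mulrnAl.
Qed.

Lemma size_w_exp n : (size (w ^+ n) <= n.*2.+1)%N.
Proof.
by rewrite (leq_trans (size_poly_exp_leq _ _))// size_XnsubC// mul2n.
Qed.

(** As [w] is monic of degree 2, multiplying by it moves the top coefficient up two places
    unchanged. The induction passes one factor [w] to [q] at a time. *)
Lemma coef_w_expM m n q : (size q <= n.+1)%N ->
  (w ^+ m * q)`_(m.*2 + n) = q`_n.
Proof.
elim: m n q => [|m IH] n q qn; first by rewrite expr0 mul1r add0n.
rewrite exprSr -mulrA doubleS addSnnS addSnnS IH; last first.
  by rewrite (leq_trans (size_polyMleq _ _))// size_XnsubC.
rewrite mulrBl mul1r coefB coefXnM ltnNge !ltnS leq0n /= subn2.
by rewrite [X in _ - X]nth_default ?subr0// (leq_trans qn).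
Qed.

(** Integration by parts of X times the derivative of [w ^+ n.+1], combined with X^2 = w + 1. *)
Lemma poly_int_w_expS n :
  (n.*2 + 3)%:R * poly_int (w ^+ n.+1) = - (n.+1.*2)%:R * poly_int (w ^+ n).
Proof.
have := @poly_int_parts (w ^+ n.+1) 'X.
have [] := @horner_derivn_vanish n.+1 1 0 isT; rewrite !derivn0 mul1r => -> ->.
move=> /(_ erefl erefl); rewrite derivX mul1r deriv_exp /=.
have -> : 'X * (w^`() * w ^+ n *+ n.+1) =
    (n.+1.*2)%:R *: (w ^+ n.+1 + w ^+ n).
  have -> : w ^+ n.+1 + w ^+ n = 'X^2 * w ^+ n by rewrite exprS /w; ring.
  rewrite /w derivB derivXn derivC subr0 expr1 scaler_nat -muln2 mulrnA.
  by rewrite mulrnAr !mulrnAl mulrnAr mulrA -expr2 mulrnAC.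
rewrite poly_intZ poly_intD natrD.
rewrite -addnn natrD -addn1 natrD => h; rewrite -[n.*2]addnn natrD; lra.
Qed.

(** Closed form of the integral of (t^2 - 1)^n, from the preceding recursion, with the denominator
    (2n+1)! cleared. *)
Lemma poly_int_w_exp n :
  (n.*2.+1)`!%:R * poly_int (w ^+ n) = (-1) ^+ n * 2 ^+ n.*2.+1 * n`!%:R ^+ 2.
Proof.
elim: n => [|n IH].
  rewrite !expr0 mul1r fact0 expr1n mulr1 expr1 mul1r.
  by rewrite -[X in poly_int X]derivX poly_int_deriv !hornerX opprK.
have := poly_int_w_expS n; rewrite addn3 => h.
rewrite doubleS factS natrM -mulrA mulrCA h factS natrM.
rewrite [LHS](_ : _ = - (n.*2.+2%:R ^+ 2) * ((n.*2.+1)`!%:R * poly_int (w ^+ n))); last first.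
  by rewrite doubleS; ring.
rewrite IH factS !natrM (_ : n.*2.+2%:R = 2 * n.+1%:R :> R); last first.
  by rewrite -natrM mul2n.
by rewrite !exprS; ring.
Qed.

Lemma size_legendre l : (size (legendre R l) <= l.+1)%N.
Proof.
apply/leq_sizeP => i li; rewrite coefZ coef_derivn nth_default ?mul0rn ?mulr0//.
by rewrite (leq_trans (size_w_exp l))// -addnn -addnS leq_add2l.
Qed.

Lemma coef_legendre l :
  (legendre R l)`_l = (2 ^+ l * l`!%:R)^-1 * (l.*2 ^_ l)%:R.
Proof.
rewrite coefZ coef_derivn addnn -[w ^+ l]mulr1 -[X in _`_X]addn0.
by rewrite coef_w_expM ?size_poly1// coef1.
Qed.

(** By Rodrigues' formula, [l] integrations by parts put all derivatives on [g], leaving the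
    constant l! g_l. In particular the integral vanishes when [g] has degree below [l]. *)
Lemma poly_int_legendre l g : (size g <= l.+1)%N ->
  poly_int (g * legendre R l) =
  (2 ^+ l * l`!%:R)^-1 * ((-1) ^+ l * (l`!%:R * g`_l * poly_int (w ^+ l))).
Proof.
move=> gl; rewrite -scalerAr poly_intZ poly_int_partsn => [|k kl]; last first.
  by rewrite -[w ^+ l]mul1r; exact: horner_derivn_vanish.
congr (_ * (_ * _)); rewrite (_ : g^`(l) = (l`!%:R * g`_l)%:P).
  by rewrite mul_polyC poly_intZ.
apply/polyP => i; rewrite coef_derivn coefC; case: i => [|i] /=.
  by rewrite addn0 ffactnn mulr_natl.
by rewrite nth_default ?mul0rn// (leq_trans gl)// addnS ltnS leq_addr.
Qed.

(** Before the outer derivatives the degree is at most 2m + (l - m) = l + m, and [m] derivatives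
    bring it down to [l]. The two rounds of differentiation contribute l!/(l-m)! and (l+m)!/l! to
    the top coefficient. *)
Let assoc_top m l : (m <= l)%N ->
  let g := (w ^+ m * (legendre R l)^`(m))^`(m) in
  (size g <= l.+1)%N /\
  g`_l = (legendre R l)`_l * ((l + m)`!%:R / (l - m)`!%:R).
Proof.
move=> ml g.
have sP : (size ((legendre R l)^`(m)) <= (l - m).+1)%N.
  apply/leq_sizeP => i li; rewrite coef_derivn nth_default ?mul0rn//.
  by rewrite (leq_trans (size_legendre l))// -leq_subLR subSn.
split.
  apply/leq_sizeP => i li; rewrite coef_derivn nth_default ?mul0rn//.
  rewrite (leq_trans (size_polyMleq _ _))//.
  by have := size_w_exp m; lia.
rewrite coef_derivn (_ : (m + l = m.*2 + (l - m))%N); last by lia.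
rewrite coef_w_expM// coef_derivn subnKC//.
rewrite -[LHS]mulr_natr -[X in X * _]mulr_natr -mulrA; congr (_ * _).
have f0 n : (n`!%:R : R) != 0 by rewrite pnatr_eq0 -lt0n fact_gt0.
apply: (@mulIf _ (l - m)`!%:R) => //; rewrite divfK// -mulrA -!natrM.
rewrite (_ : (m.*2 + (l - m)) = l + m)%N; last by lia.
congr (_%:R).
by rewrite mulnCA ffact_fact// -(@ffact_fact (l + m) m) ?leq_addl// addnK.
Qed.

(** Moving [m] derivatives off P_l turns the integral into that of P_l against a polynomial of
    degree at most l'. It vanishes for l' < l, and for l' = l only top coefficients matter. The sign
    of the parts cancels that of (1 - X^2)^m = (-1)^m w^m. *)
Lemma poly_int_assoc_legendre m l l' : (m <= l)%N -> (m <= l')%N ->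
  poly_int ((1 - 'X^2) ^+ m * ((legendre R l)^`(m) * (legendre R l')^`(m))) =
  if l == l' then 2 / l.*2.+1%:R * ((l + m)`!%:R / (l - m)`!%:R) else 0.
Proof.
(* By symmetry the Legendre polynomial of larger degree is the one to be tested against the other
   factor. *)
wlog l'l : l l' / (l' <= l)%N.
  move=> H ml ml'; have [|/ltnW] := leqP l' l; first by move/H; apply.
  by move=> /H/(_ ml' ml); rewrite eq_sym; case: eqP => [->//|_]; rewrite [X in _ * X]mulrC.
move=> ml ml'.
set f := (legendre R l')^`(m) * w ^+ m.
have -> : (1 - 'X^2) ^+ m * ((legendre R l)^`(m) * (legendre R l')^`(m)) =
    (-1) ^+ m *: ((legendre R l)^`(m) * f).
  have -> (g : {poly R}) : (-1) ^+ m *: g = (-1) ^+ m * g.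
    rewrite -signr_odd -[in RHS]signr_odd; case: odd.
      by rewrite !expr1 scaleN1r mulN1r.
    by rewrite !expr0 scale1r mul1r.
  rewrite -opprB [in LHS]exprNn /f -!mulrA.
  by congr (_ * _); rewrite mulrC -mulrA.
have [sf fl'] := assoc_top ml'; rewrite [w ^+ m * _]mulrC -/f in sf fl'.
have /poly_int_partsn : forall k, (k < m)%N -> f^`(k).[1] = 0 /\ f^`(k).[-1] = 0.
  by move=> k; exact: horner_derivn_vanish.
move=> /(_ (legendre R l)) fparts.
rewrite poly_intZ -fparts mulrC.
rewrite poly_int_legendre; last exact: leq_trans sf _.
case: eqVneq => [ll'|ll']; last first.
  rewrite [f^`(m)`_l]nth_default; first by rewrite mulr0 mul0r !mulr0.
  by rewrite (leq_trans sf)// ltn_neqAle eq_sym ll'.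
subst l'; rewrite fl' coef_legendre.
have := poly_int_w_exp l.
have f0 n : (n`!%:R : R) != 0 by rewrite pnatr_eq0 -lt0n fact_gt0.
(* The factorial is split so that the falling factorial in the leading coefficient of P_l meets the
   closed form of the integral of [w ^+ l]. *)
have -> : (l.*2.+1)`!%:R = l.*2.+1%:R * ((l.*2 ^_ l)%:R * l`!%:R) :> R.
  by rewrite factS natrM -(@ffact_fact l.*2 l) -?addnn ?leq_addl// addnK natrM.
have t0 : (2 ^+ l : R) != 0 by rewrite expf_neq0// pnatr_eq0.
have n0 : (l.*2.+1%:R : R) != 0 by rewrite pnatr_eq0.
have e2 : (-1) ^+ l * (-1) ^+ l = 1 :> R by rewrite -exprMn mulrNN mul1r expr1n.
have -> : (2 ^+ l.*2.+1 : R) = 2 * (2 ^+ l * 2 ^+ l) by rewrite exprS -addnn exprD.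
move: (f0 l) t0 n0 e2; move: (_ / _) (2 ^+ l) ((-1) ^+ l) (l.*2.+1%:R) (poly_int _).
move: (l`!%:R) ((l.*2 ^_ l)%:R) => a F X t e n J a0 t0 n0 e2 h.
apply: (mulfI n0); rewrite [RHS](_ : _ = 2 * X); last by field.
rewrite [LHS](_ : _ = (t * a)^-1 ^+ 2 * e * X * (n * (F * a) * J)); last first.
  by ring.
rewrite h [LHS](_ : _ = (e * e) * (2 * X)); last by field; apply/andP.
by rewrite e2 mul1r.
Qed.

End PolynomialIntegral.

(** * Integration in spherical coordinates *)

Section SurfaceIntegral.
Variable R : realType.
Local Open Scope ereal_scope.

Local Notation leb := (@lebesgue_measure R).
Local Notation sigma := (surface_measure R).

Import HBNNSimple.

Let measurable_sin1 (D : set (R * R)) :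
  measurable_fun D (fun u : R * R => (sin u.1)%:E).
Proof.
apply: measurable_funTS; apply: measurableT_comp => //=.
apply: measurableT_comp => //.
by apply: continuous_measurable_fun; exact: continuous_sin.
Qed.

(** The definition of [surface_measure] is this formula for indicators. It extends to simple
    functions by linearity and to nonnegative measurable functions by monotone convergence. *)
Lemma ge0_integral_surface_measure (f : R * R * R -> \bar R) :
  measurable_fun setT f -> (forall x, 0 <= f x) ->
  \int[sigma]_x f x =
  \int[leb \x leb]_(u in angle_box R)
    (f (spherical_coord u) * (sin u.1)%:E).
Proof.
move=> mf f0; pose h := nnsfun_approx measurableT mf.
have mbox := @measurable_angle_box R.
have msc := @measurable_spherical_coord R.
have hf x : (EFin \o h n) x @[n --> \oo] --> f x.
  by apply: cvg_nnsfun_approx.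
have -> : \int[sigma]_x f x = lim (\int[sigma]_x (EFin \o h n) x @[n --> \oo]).
  under eq_integral => x _ do rewrite -(cvg_lim _ (hf x))//.
  apply: monotone_convergence => //.
  - by move=> n; exact/measurable_EFinP/measurable_funP.
  - by move=> n x _ /=; rewrite lee_fin.
  - by move=> x _ a b ab; rewrite lee_fin; exact/lefP/nd_nnsfun_approx.
have -> : \int[leb \x leb]_(u in angle_box R)
      (f (spherical_coord u) * (sin u.1)%:E) =
    lim (\int[leb \x leb]_(u in angle_box R)
      ((EFin \o h n) (spherical_coord u) * (sin u.1)%:E) @[n --> \oo]).
  transitivity (\int[leb \x leb]_(u in angle_box R)
      lim ((EFin \o h n) (spherical_coord u) * (sin u.1)%:E @[n --> \oo])).
    apply: eq_integral => u _; apply/esym/cvg_lim => //.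
    by apply: cvgeZr => //; exact: hf.
  apply: monotone_convergence => //.
  - move=> n; apply: emeasurable_funM; last exact: measurable_sin1.
  apply: measurable_funTS.
    by apply/measurable_EFinP; apply: measurableT_comp.
  - by move=> n u /angle_box_sin_ge0 s0 /=; rewrite mule_ge0 ?lee_fin.
  - move=> u /angle_box_sin_ge0 s0 a b ab /=.
    by rewrite lee_wpmul2r ?lee_fin//; exact/lefP/nd_nnsfun_approx.
(* Both sides are now limits along the same simple functions, so it suffices to compare them for
   each [n]. *)
suff suf n : \int[leb \x leb]_(u in angle_box R)
      ((EFin \o h n) (spherical_coord u) * (sin u.1)%:E) =
    \int[sigma]_x (EFin \o h n) x.
  by under [in RHS]eq_fun do rewrite suf.
have mh r : measurable (h n @^-1` [set r]) by [].
transitivity (\int[leb \x leb]_(u in angle_box R) (\sum_(y \in range (h n))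
    ((y * \1_(h n @^-1` [set y]) (spherical_coord u))%:E * (sin u.1)%:E))).
  apply: eq_integral => u /[!inE] /angle_box_sin_ge0 s0.
  rewrite -ge0_mule_fsuml => [|y]; last exact: nnfun_muleindic_ge0.
  by rewrite fsumEFin // -(fimfunE _ (spherical_coord u)).
rewrite ge0_integral_fsum//; last 2 first.
- move=> y; apply: emeasurable_funM; last exact: measurable_sin1.
  apply: measurable_funTS.
  apply/measurable_EFinP; apply: measurable_funM => //.
  exact: measurableT_comp.
- move=> y u /angle_box_sin_ge0 s0.
  by rewrite mule_ge0 ?lee_fin//; have := nnfun_muleindic_ge0 (h n) y (spherical_coord u).
transitivity (\int[sigma]_x
   (\sum_(y \in range (h n)) (y * \1_(h n @^-1` [set y]) x)%:E)); last first.
  by apply: eq_integral => t tE; rewrite /= fimfunE -fsumEFin.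
rewrite ge0_integral_fsum//; last 2 first.
- by move=> y; apply/measurable_EFinP; exact: measurable_funM.
- by move=> m y Ey; exact: nnfun_muleindic_ge0.
apply: eq_fsbigr => r rhn.
have r0 : (0 <= r)%R by move: rhn; rewrite inE => -[t _ <-].
rewrite integralZl_indic_nnsfun // integral_indic// setIT.
under eq_integral do rewrite EFinM -muleA.
rewrite ge0_integralZl//; last 2 first.
- apply: emeasurable_funM; last exact: measurable_sin1.
  apply: measurable_funTS.
  by apply/measurable_EFinP; exact: measurableT_comp.
- by move=> u /angle_box_sin_ge0 s0; rewrite mule_ge0 ?lee_fin.
(* For a single level set only the definition remains, the indicator being absorbed into the domain
   of integration. *)
congr (_ * _); rewrite /surface_measure [RHS]integral_mkcondr.
apply: eq_integral => u _; rewrite muleC epatch_indic //.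
Qed.


(** Tonelli: the iterated integral of the modulus is the product of the finite integrals of |g| and
    |h|. *)
Lemma integrable_prod_fun (g h : R -> R) :
  leb.-integrable setT (EFin \o g) -> leb.-integrable setT (EFin \o h) ->
  (leb \x leb).-integrable setT (fun u => (g u.1 * h u.2)%:E).
Proof.
move=> ig ih; have mg := measurable_int _ ig; have mh := measurable_int _ ih.
apply/integrable12ltyP.
  apply/measurable_EFinP; apply: measurable_funM; apply: measurableT_comp => //.
    exact/measurable_EFinP.
  exact/measurable_EFinP.
rewrite /=; under eq_integral => x _.
  under eq_integral do rewrite normrM EFinM.
  rewrite ge0_integralZl//; last by do 2 apply: measurableT_comp => //; exact/measurable_EFinP.
  over.
have fh : \int[leb]_y `|h y|%:E \is a fin_num.
  by have := integrable_fin_num measurableT (integrable_abse ih); apply.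
rewrite ge0_integralZr//; last 2 first.
- by do 2 apply: measurableT_comp => //; exact/measurable_EFinP.
- by apply: integral_ge0 => y _; rewrite lee_fin.
have fg : \int[leb]_y `|g y|%:E \is a fin_num.
  by have := integrable_fin_num measurableT (integrable_abse ig); apply.
by rewrite -(fineK fh) -(fineK fg) -EFinM ltry.
Qed.

Lemma integral_prod_fun (g h : R -> R) :
  leb.-integrable setT (EFin \o g) -> leb.-integrable setT (EFin \o h) ->
  \int[leb \x leb]_u (g u.1 * h u.2)%:E =
  (\int[leb]_x (g x)%:E) * (\int[leb]_x (h x)%:E).
Proof.
move=> ig ih; rewrite -integral12_prod_meas1; last exact: integrable_prod_fun.
rewrite /fubini_F /=; under eq_integral => x _.
  under eq_integral do rewrite EFinM.
  rewrite integralZl//; over.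
have fh : \int[leb]_y (h y)%:E \is a fin_num by exact: (integrable_fin_num measurableT ih).
by rewrite -(fineK fh) integralZr.
Qed.

Lemma integral_angle_box (g h : R -> R) : continuous g -> continuous h ->
  (leb \x leb).-integrable (angle_box R) (fun u => (g u.1 * h u.2)%:E) /\
  \int[leb \x leb]_(u in angle_box R) (g u.1 * h u.2)%:E =
  (\int[leb]_(x in `[0%R, pi]) (g x)%:E) *
  (\int[leb]_(x in `[0%R, (2 * pi)%R]) (h x)%:E).
Proof.
move=> cg ch.
have rI (k : R -> R) a b : continuous k ->
    leb.-integrable setT (EFin \o (k \_ `[a, b])%R).
  move=> ck; rewrite -restrict_EFin -integrable_restrict// setTI.
  apply: continuous_compact_integrable; first exact: segment_compact.
  exact: continuous_subspaceT.
(* The indicator of a box is a product of indicators, so extension by zero keeps the variables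
   separated. *)
have rE : (fun u => (g u.1 * h u.2)%:E) \_ (angle_box R) =
    (fun u : R * R => ((g \_ `[0%R, pi]) u.1 * (h \_ `[0, (2 * pi)]) u.2)%:E)%R.
  apply/funext => -[x y]; rewrite /angle_box !patchE/= in_setX /=.
  by case: ifPn => [/andP[-> ->]//|]; rewrite negb_and => /orP[]/negbTE ->;
    rewrite ?mul0r ?mulr0.
split.
  apply/integrable_mkcond; first exact: measurable_angle_box.
  by rewrite rE; apply: integrable_prod_fun; exact: rI.
rewrite integral_mkcond rE integral_prod_fun; [|exact: rI..].
by congr (_ * _); rewrite [RHS]integral_mkcond; apply: eq_integral => x _;
  rewrite !patchE; case: ifP.
Qed.

Lemma continuous_FTC (f F : R -> R) (a b : R) : (a < b)%R -> continuous f ->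
  (forall x, is_derive x (1%R : R) F (f x)) ->
  \int[leb]_(x in `[a, b]) (f x)%:E = (F b)%:E - (F a)%:E.
Proof.
move=> ab cf dF; have cF : continuous F.
  by move=> x; apply/differentiable_continuous/derivable1_diffP.
apply: continuous_FTC2 => //.
- exact: continuous_subspaceT.
- split; first by move=> x _.
  + by apply: cvg_at_right_filter; exact: cF.
  + by apply: cvg_at_left_filter; exact: cF.
- by move=> x _; rewrite derive1E derive_val.
Qed.

Lemma integrable_surface_measure (f : R * R * R -> R) : measurable_fun setT f ->
  (leb \x leb).-integrable (angle_box R)
    (fun u => (f (spherical_coord u) * sin u.1)%:E) ->
  sigma.-integrable setT (EFin \o f).
Proof.
move=> mf fI; apply/integrableP; split; first exact/measurable_EFinP.
rewrite ge0_integral_surface_measure//; last first.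
  by apply: measurableT_comp => //; exact/measurable_EFinP.
have /integrableP[_] := fI; apply: le_lt_trans.
rewrite le_eqVlt; apply/orP; left; apply/eqP.
apply: eq_integral => u /[!inE] /angle_box_sin_ge0 s0.
rewrite [RHS](_ : _ = `|f (spherical_coord u) * sin u.1|%R%:E)//.
by rewrite normrM (ger0_norm s0).
Qed.

(** As [sin u.1] is nonnegative on the box, the weight commutes with positive and negative parts,
    and the nonnegative case applies to each. *)
Lemma integral_surface_measure (f : R * R * R -> R) : measurable_fun setT f ->
  (leb \x leb).-integrable (angle_box R)
    (fun u => (f (spherical_coord u) * sin u.1)%:E) ->
  \int[sigma]_x (f x)%:E =
  \int[leb \x leb]_(u in angle_box R) (f (spherical_coord u) * sin u.1)%:E.
Proof.
move=> mf fI; rewrite integralE [RHS]integralE.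
have mF : measurable_fun setT (EFin \o f) by exact/measurable_EFinP.
rewrite !ge0_integral_surface_measure//; last 2 first.
- exact: measurable_funeneg.
- exact: measurable_funepos.
congr (_ - _); apply: eq_integral => u /[!inE] /angle_box_sin_ge0 s0.
  by rewrite !funeposE muleC maxe_pMr// mule0 muleC -EFinM.
by rewrite !funenegE muleC maxe_pMr// mule0 muleC mulNe -EFinM.
Qed.

End SurfaceIntegral.

(** * Orthonormality of the spherical harmonics *)

Section ComplexParts.
Variable R : realType.
Implicit Types x y : R[i].

Lemma complexReM x y : complex.Re (x * y) =
  complex.Re x * complex.Re y - complex.Im x * complex.Im y.
Proof. by case: x y => [a b] []. Qed.

Lemma complexImM x y : complex.Im (x * y) =
  complex.Re x * complex.Im y + complex.Im x * complex.Re y.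
Proof. by case: x y => [a b] []. Qed.

Lemma complexReJ x : complex.Re x^*%C = complex.Re x.
Proof. by case: x. Qed.

Lemma complexImJ x : complex.Im x^*%C = - complex.Im x.
Proof. by case: x. Qed.

End ComplexParts.

Section SphericalHarmonicsOrthonormal.
Variable R : realType.
Local Notation leb := (@lebesgue_measure R).
Local Notation sigma := (surface_measure R).

Let sin_cos_nat2pi (n : nat) :
  cos (n%:R * (2 * pi)) = 1 :> R /\ sin (n%:R * (2 * pi)) = 0 :> R.
Proof.
rewrite [2 * pi]mulr_natl.
elim: n => [|n [IHc IHs]]; first by rewrite mul0r cos0 sin0.
rewrite -addn1 natrD mulrDl mul1r cosD2pi sinD2pi; split => //.
Qed.

Lemma cos_int2pi (n : int) : cos (n%:~R * (2 * pi)) = 1 :> R.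
Proof.
case: n => n; first by rewrite -pmulrn (sin_cos_nat2pi n).1.
by rewrite NegzE mulrNz mulNr cosN -pmulrn (sin_cos_nat2pi n.+1).1.
Qed.

Lemma sin_int2pi (n : int) : sin (n%:~R * (2 * pi)) = 0 :> R.
Proof.
case: n => n; first by rewrite -pmulrn (sin_cos_nat2pi n).2.
by rewrite NegzE mulrNz mulNr sinN -pmulrn (sin_cos_nat2pi n.+1).2 oppr0.
Qed.

Let twopi_gt0 : (0 < 2 * pi :> R). Proof. by rewrite mulr_gt0 ?pi_gt0. Qed.

Lemma continuous_cosM (c : R) : continuous (fun x : R => cos (c * x)).
Proof.
move=> x; apply: (@continuous_comp _ _ _ ( *%R c) (@cos R)).
  exact: mulrl_continuous.
exact: continuous_cos.
Qed.

Lemma continuous_sinM (c : R) : continuous (fun x : R => sin (c * x)).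
Proof.
move=> x; apply: (@continuous_comp _ _ _ ( *%R c) (@sin R)).
  exact: mulrl_continuous.
exact: continuous_sin.
Qed.

Lemma integral_cos_int (n : int) :
  (\int[leb]_(x in `[0%R, (2 * pi)%R]) (cos (n%:~R * x))%:E =
   (if n == 0 then 2 * pi else 0)%:E)%E.
Proof.
have [->|n0] := eqVneq n 0.
  under eq_integral do rewrite mul0r cos0.
  rewrite (@continuous_FTC _ (cst 1) id)// ?sube0//.
  exact: cst_continuous.
have nR0 : n%:~R != 0 :> R by rewrite intr_eq0.
have dF (x : R) : is_derive x (1 : R) (fun x : R => n%:~R^-1 * sin (n%:~R * x))
    (cos (n%:~R * x)).
  apply: trigger_derive.
  by rewrite /= /GRing.scale /= mulr1; field.
rewrite (continuous_FTC _ _ dF)//; last exact: continuous_cosM.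
by rewrite sin_int2pi !mulr0 sin0 !mulr0 subee.
Qed.

Lemma integral_sin_int (n : int) :
  (\int[leb]_(x in `[0%R, (2 * pi)%R]) (sin (n%:~R * x))%:E = 0)%E.
Proof.
have [->|n0] := eqVneq n 0.
  under eq_integral do rewrite mul0r sin0.
  by rewrite integral0.
have nR0 : n%:~R != 0 :> R by rewrite intr_eq0.
have dF (x : R) : is_derive x (1 : R) (fun x : R => - (n%:~R^-1 * cos (n%:~R * x)))
    (sin (n%:~R * x)).
  apply: trigger_derive.
  by rewrite /= /GRing.scale /= mulr1; field.
rewrite (continuous_FTC _ _ dF)//; last exact: continuous_sinM.
by rewrite cos_int2pi mulr0 cos0 subee.
Qed.

Lemma continuous_horner_cos (p : {poly R}) : continuous (fun x : R => p.[cos x]).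
Proof.
move=> x; apply: (@continuous_comp _ _ _ (@cos R) (horner p)).
  exact: continuous_cos.
exact: continuous_horner.
Qed.

(** The substitution t = cos theta, carried out through the primitive -P(cos theta). It links
    colatitude integrals to [poly_int]. *)
Lemma integral_horner_cos (p : {poly R}) :
  (\int[leb]_(x in `[0%R, pi]) (p.[cos x] * sin x)%:E = (poly_int p)%:E)%E.
Proof.
have dF (x : R) : is_derive x (1 : R) (fun x : R => - (poly_prim p).[cos x])
    (p.[cos x] * sin x).
  apply: trigger_derive.
  by rewrite /= deriv_poly_prim; ring.
rewrite (continuous_FTC _ _ dF) ?pi_gt0//; last first.
  move=> x; apply: cvgM; first exact: continuous_horner_cos.
  exact: continuous_sin.
by rewrite cospi cos0 -EFinN -EFinD opprK addrC.
Qed.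

(** The part of Y_{l,m} depending on theta. For negative orders no sign appears, because the sign of
    the reflection rule cancels the one inside [sph_harm_nneg]. *)
Definition colat_factor (l : nat) (m : int) (t : R) : R :=
  Num.sqrt ((l.*2.+1)%:R / (4 * pi) * ((l - `|m|)`!%:R / (l + `|m|)`!%:R))
  * (if m is Posz k then (-1) ^+ k else 1)
  * sin t ^+ `|m| * ((legendre R l)^`(`|m|)).[cos t].

(** De Moivre's formula; it is used with radius sin theta. *)
Let expr_polar (r t : R) k :
  Complex (r * cos t) (r * sin t) ^+ k =
  Complex (r ^+ k * cos (k%:R * t)) (r ^+ k * sin (k%:R * t)).
Proof.
elim: k => [|k IH]; first by rewrite expr0 mul0r cos0 sin0 expr0 mulr1 mulr0.
rewrite exprS IH -[k.+1]add1n natrD mulrDl mul1r cosD sinD.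
by apply/eqP; rewrite eq_complex complexReM complexImM /= exprS; apply/andP; split; apply/eqP; ring.
Qed.

Lemma sph_harm_spherical_coord l (m : int) (u : R * R) :
  sph_harm l m (spherical_coord u) =
  Complex (colat_factor l m u.1 * cos (m%:~R * u.2))
          (colat_factor l m u.1 * sin (m%:~R * u.2)).
Proof.
have nneg k : sph_harm_nneg l k (spherical_coord u) =
    Complex (colat_factor l k u.1 * cos (k%:R * u.2))
            (colat_factor l k u.1 * sin (k%:R * u.2)).
  rewrite /sph_harm_nneg /= expr_polar /colat_factor absz_nat.
  have -> : (-1) ^+ k = real_complex R ((-1) ^+ k) by rewrite rmorphXn rmorphN1.
  apply/eqP; rewrite eq_complex !(complexReM, complexImM) /=.
  by apply/andP; split; apply/eqP; ring.
case: m => k; first by rewrite /= nneg -pmulrn.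
rewrite /sph_harm nneg NegzE mulrNz mulNr cosN sinN -pmulrn.
have -> : (-1) ^+ k.+1 = real_complex R ((-1) ^+ k.+1) by rewrite rmorphXn rmorphN1.
have -> : colat_factor l (- k.+1%:Z) u.1 = (-1) ^+ k.+1 * colat_factor l k.+1 u.1.
  rewrite /colat_factor abszN absz_nat mulr1; have := sqrr_sign R k.+1.
  move: ((-1) ^+ k.+1) => s s2; rewrite [RHS](_ : _ = s ^+ 2 *
    (Num.sqrt ((l.*2.+1)%:R / (4 * pi) * ((l - k.+1)`!%:R / (l + k.+1)`!%:R))
     * sin u.1 ^+ k.+1 * ((legendre R l)^`(k.+1)).[cos u.1])); last by ring.
  by rewrite s2 mul1r.
apply/eqP; rewrite eq_complex !(complexReM, complexImM, complexReJ, complexImJ) /=.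
by apply/andP; split; apply/eqP; ring.
Qed.

Lemma continuous_colat_factor l m : continuous (colat_factor l m).
Proof.
rewrite /colat_factor => t.
apply: cvgM; last exact: continuous_horner_cos.
apply: cvgM; first exact: cst_continuous.
apply: (@continuous_comp _ _ _ (@sin R) (fun x => x ^+ `|m|)).
  exact: continuous_sin.
exact: exprn_continuous.
Qed.


Let amp2_pos l k : (k <= l)%N ->
  Num.sqrt ((l.*2.+1)%:R / (4 * pi) * ((l - k)`!%:R / (l + k)`!%:R)) ^+ 2 =
  (l.*2.+1)%:R / (4 * pi) * ((l - k)`!%:R / (l + k)`!%:R) :> R.
Proof.
by move=> kl; rewrite sqr_sqrtr// !mulr_ge0 ?invr_ge0 ?mulr_ge0 ?pi_ge0 ?ler0n.
Qed.

(** With t = cos theta this is the orthogonality of associated Legendre functions. The normalization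
    leaves 1/(2 pi), to be compensated by the longitude. *)
Lemma integral_colat_factor l l' m : (`|m| <= l)%N -> (`|m| <= l')%N ->
  (\int[leb]_(t in `[0%R, pi])
     (colat_factor l m t * colat_factor l' m t * sin t)%:E =
   (if l == l' then (2 * pi)^-1 else 0)%:E)%E.
Proof.
move=> ml ml'; set k := `|m|%N in ml ml' *.
pose N j : R := Num.sqrt ((j.*2.+1)%:R / (4 * pi) * ((j - k)`!%:R / (j + k)`!%:R)).
pose p := (N l * N l') *: ((1 - 'X^2) ^+ k *
  ((legendre R l)^`(k) * (legendre R l')^`(k))).
transitivity (\int[leb]_(t in `[0%R, pi]) (p.[cos t] * sin t)%:E)%E.
  apply: eq_integral => t _; congr (_ * _)%:E.
  have -> : p.[cos t] = N l * N l' * ((sin t ^+ 2) ^+ k *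
      ((legendre R l)^`(k).[cos t] * (legendre R l')^`(k).[cos t])).
    by rewrite /p !(hornerZ, hornerM) horner_exp !hornerE -(cos2Dsin2 t) addrC addKr.
  rewrite -exprM mulnC exprM expr2.
  (* Both factors have the same order, hence the same sign [s], which disappears as [s ^+ 2 = 1]. *)
  pose s : R := if m is Posz j then (-1) ^+ j else 1.
  have s2 : s ^+ 2 = 1 by rewrite /s; case: (m) => j; rewrite ?sqrr_sign ?expr1n.
  have cE j : colat_factor j m t = N j * s * sin t ^+ k * ((legendre R j)^`(k)).[cos t] by [].
  rewrite !cE.
  rewrite [LHS](_ : _ = s ^+ 2 * (N l * N l' * (sin t ^+ k * sin t ^+ k *
    ((legendre R l)^`(k).[cos t] * (legendre R l')^`(k).[cos t])))); last by ring.
  by rewrite s2 mul1r.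
rewrite integral_horner_cos poly_intZ poly_int_assoc_legendre//; congr EFin.
case: eqVneq => [<-|_]; last by rewrite mulr0.
rewrite -expr2 amp2_pos//.
have f0 n : (n`!%:R : R) != 0 by rewrite pnatr_eq0 -lt0n fact_gt0.
have n0 : (l.*2.+1%:R : R) != 0 by rewrite pnatr_eq0.
have := lt0r_neq0 (pi_gt0 R); move: (f0 (l - k)%N) (f0 (l + k)%N) n0.
move: pi (l - k)`!%:R (l + k)`!%:R (l.*2.+1)%:R => P a b c a0 b0 c0 P0.
by field; rewrite P0 a0 b0 c0.
Qed.

(** The phases combine into exp(i (m' - m) phi), so the product separates the two angles. *)
Let Re_pull l l' m m' (u : R * R) :
  complex.Re ((sph_harm l m (spherical_coord u))^*%C *
              sph_harm l' m' (spherical_coord u)) =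
  colat_factor l m u.1 * colat_factor l' m' u.1 * cos ((m' - m)%:~R * u.2).
Proof.
rewrite !sph_harm_spherical_coord complexReM complexReJ complexImJ /=.
by rewrite rmorphB mulrBl cosB; ring.
Qed.

Let Im_pull l l' m m' (u : R * R) :
  complex.Im ((sph_harm l m (spherical_coord u))^*%C *
              sph_harm l' m' (spherical_coord u)) =
  colat_factor l m u.1 * colat_factor l' m' u.1 * sin ((m' - m)%:~R * u.2).
Proof.
rewrite !sph_harm_spherical_coord complexImM complexReJ complexImJ /=.
by rewrite rmorphB mulrBl sinB; ring.
Qed.

(** * Componentwise measurability of complex-valued functions *)

Definition cmeasurable (f : R * R * R -> R[i]) :=
  measurable_fun setT (@complex.Re R \o f) /\ measurable_fun setT (@complex.Im R \o f).

Lemma cmeasurableM f g : cmeasurable f -> cmeasurable g ->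
  cmeasurable (fun x => f x * g x).
Proof.
move=> [rf imf] [rg img]; split.
  rewrite (_ : _ \o _ = fun x => complex.Re (f x) * complex.Re (g x)
    - complex.Im (f x) * complex.Im (g x)); last by apply/funext => x /=; rewrite complexReM.
  by apply: measurable_funB; apply: measurable_funM.
rewrite (_ : _ \o _ = fun x => complex.Re (f x) * complex.Im (g x)
  + complex.Im (f x) * complex.Re (g x)); last by apply/funext => x /=; rewrite complexImM.
by apply: measurable_funD; apply: measurable_funM.
Qed.

Lemma cmeasurable_cst c : cmeasurable (fun=> c).
Proof. by split; exact: measurable_cst. Qed.

Lemma cmeasurable_conj f : cmeasurable f -> cmeasurable (fun x => (f x)^*%C).
Proof.
move=> [rf imf]; split.
  by rewrite (_ : _ \o _ = @complex.Re R \o f)//; apply/funext => x /=; rewrite complexReJ.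
rewrite (_ : _ \o _ = fun x => - complex.Im (f x)); last first.
  by apply/funext => x /=; rewrite complexImJ.
exact: measurableT_comp.
Qed.

Lemma cmeasurable_real (f : R * R * R -> R) : measurable_fun setT f ->
  cmeasurable (fun x => real_complex R (f x)).
Proof. by move=> mf; split => //; exact: measurable_cst. Qed.

Lemma cmeasurableX f n : cmeasurable f -> cmeasurable (fun x => f x ^+ n).
Proof.
move=> mf; elim: n => [|n IH]; first exact: cmeasurable_cst.
rewrite (_ : (fun x => _) = fun x => f x * f x ^+ n); first exact: cmeasurableM.
by apply/funext => x; rewrite exprS.
Qed.

Lemma cmeasurable_sph_harm l m : cmeasurable (@sph_harm R l m).
Proof.
have nneg k : cmeasurable (@sph_harm_nneg R l k).
  apply: cmeasurableM; last first.
    apply: cmeasurable_real; apply: measurableT_comp => //.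
    by apply: continuous_measurable_fun; exact: continuous_horner.
  apply: cmeasurableM; first exact: cmeasurable_cst.
  apply: cmeasurableX; split; rewrite /comp /=; exact: measurableT_comp.
case: m => k; first exact: nneg.
by apply: cmeasurableM; [exact: cmeasurable_cst|exact/cmeasurable_conj/nneg].
Qed.

Let kernel_box l l' m m' (F : R -> R) : continuous F ->
  let G := fun t => colat_factor l m t * colat_factor l' m' t * sin t in
  ((leb \x leb).-integrable (angle_box R) (fun u => (G u.1 * F u.2)%:E) /\
  \int[leb \x leb]_(u in angle_box R) (G u.1 * F u.2)%:E =
  (\int[leb]_(x in `[0%R, pi]) (G x)%:E) *
  (\int[leb]_(x in `[0%R, (2 * pi)%R]) (F x)%:E))%E.
Proof.
move=> cF G; apply: integral_angle_box => // t.
apply: cvgM; last exact: continuous_sin.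
by apply: cvgM; exact: continuous_colat_factor.
Qed.

Lemma integrable_sph_harm_kernel l l' m m' :
  let f := fun x => (sph_harm l m x)^*%C * sph_harm l' m' x in
  sigma.-integrable setT (EFin \o (@complex.Re R \o f)) /\
  sigma.-integrable setT (EFin \o (@complex.Im R \o f)).
Proof.
move=> f; have [mRe mIm] : cmeasurable f.
  apply: cmeasurableM; last exact: cmeasurable_sph_harm.
  exact/cmeasurable_conj/cmeasurable_sph_harm.
split; apply: integrable_surface_measure => //.
  have [+ _] := kernel_box l l' m m' (@continuous_cosM (m' - m)%:~R).
  apply: eq_integrable; first exact: measurable_angle_box.
  by move=> u _; rewrite /f /comp Re_pull; congr EFin; ring.
have [+ _] := kernel_box l l' m m' (@continuous_sinM (m' - m)%:~R).
apply: eq_integrable; first exact: measurable_angle_box.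
by move=> u _; rewrite /f /comp Im_pull; congr EFin; ring.
Qed.

Lemma sph_harm_orthonormal l l' m m' : (`|m| <= l)%N -> (`|m'| <= l')%N ->
  cintegral setT (fun x => (sph_harm l m x)^*%C * sph_harm l' m' x) =
  ((l == l') && (m == m'))%:R :> R[i].
Proof.
move=> ml ml'; pose f x := (sph_harm l m x)^*%C * @sph_harm R l' m' x.
have [mRe mIm] : cmeasurable f.
  apply: cmeasurableM; last exact: cmeasurable_sph_harm.
  exact/cmeasurable_conj/cmeasurable_sph_harm.
have [ic Ic] := kernel_box l l' m m' (@continuous_cosM (m' - m)%:~R).
have [is_ Is] := kernel_box l l' m m' (@continuous_sinM (m' - m)%:~R).
have ReE : (\int[sigma]_x (complex.Re (f x))%:E =
    ((l == l') && (m == m'))%:R%:E)%E.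
  have Re_eq u : complex.Re (f (spherical_coord u)) * sin u.1 =
      colat_factor l m u.1 * colat_factor l' m' u.1 * sin u.1 * cos ((m' - m)%:~R * u.2).
    by rewrite /f Re_pull; ring.
  rewrite integral_surface_measure//; last first.
    by under eq_fun do rewrite Re_eq.
  under eq_integral do rewrite Re_eq.
  rewrite Ic integral_cos_int subr_eq0 [m' == m]eq_sym.
  (* Distinct orders are annihilated by the longitude integral. For equal orders its value 2 pi
     cancels the 1/(2 pi) of the colatitude integral. *)
  have [mm'|] := eqVneq m m'; last by rewrite mule0 andbF.
  rewrite -mm' in ml' *; rewrite integral_colat_factor// -EFinM andbT.
  by case: eqP => _; rewrite ?mul0r// mulVf// lt0r_neq0.
have ImE : (\int[sigma]_x (complex.Im (f x))%:E = 0)%E.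
  have Im_eq u : complex.Im (f (spherical_coord u)) * sin u.1 =
      colat_factor l m u.1 * colat_factor l' m' u.1 * sin u.1 * sin ((m' - m)%:~R * u.2).
    by rewrite /f Im_pull; ring.
  rewrite integral_surface_measure//; last first.
    by under eq_fun do rewrite Im_eq.
  by under eq_integral do rewrite Im_eq; rewrite Is integral_sin_int mule0.
by rewrite /cintegral /Rintegral ReE ImE; case: (_ && _).
Qed.

End SphericalHarmonicsOrthonormal.

(** * Bessel's inequality on the sphere *)

Section SphereL2.
Variable R : realType.
Local Notation C := R[i].
Local Notation T := (R * R * R)%type.
Local Notation sigma := (surface_measure R).
Implicit Types (f g h : T -> C) (c z : C).

(** The squared modulus, kept as a real polynomial in the two parts so that its estimates reduce to
    real arithmetic. *)
Definition sqmod z : R := complex.Re z ^+ 2 + complex.Im z ^+ 2.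

Lemma sqmod_ge0 z : 0 <= sqmod z.
Proof. by rewrite addr_ge0 ?sqr_ge0. Qed.

Lemma sqmodM z c : sqmod (z * c) = sqmod z * sqmod c.
Proof. by rewrite /sqmod complexReM complexImM; ring. Qed.

Lemma sqmod_conj z : sqmod z^*%C = sqmod z.
Proof. by rewrite /sqmod complexReJ complexImJ sqrrN. Qed.

Lemma sqmodD z c : sqmod (z + c) <= 2 * sqmod z + 2 * sqmod c.
Proof.
rewrite /sqmod !raddfD /=; move: (complex.Re z) (complex.Re c) (complex.Im z) (complex.Im c).
by move=> x y s t; have := sqr_ge0 (x - y); have := sqr_ge0 (s - t); nra.
Qed.

Lemma sqmodB z c : sqmod (z - c) <= 2 * sqmod z + 2 * sqmod c.
Proof. by rewrite (le_trans (sqmodD _ _))// -mulN1r sqmodM /sqmod /= oppr0; lra. Qed.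

Lemma conjM_sqmod z : z^*%C * z = real_complex R (sqmod z).
Proof.
apply/eqP; rewrite eq_complex complexReM complexImM complexReJ complexImJ /sqmod /=.
by apply/andP; split; apply/eqP; ring.
Qed.

Lemma normc_sqmod z : Normc.normc z ^+ 2 = sqmod z.
Proof. by case: z => a b; rewrite /= sqr_sqrtr// addr_ge0 ?sqr_ge0. Qed.

(** A crude form of Young's inequality. It dominates products of square-integrable functions and,
    later, the terms of the series defining Y a. *)
Lemma Re_mul_conj_le z c : `|complex.Re (z^*%C * c)| <= sqmod z + sqmod c.
Proof.
rewrite complexReM complexReJ complexImJ /sqmod.
move: (complex.Re z) (complex.Re c) (complex.Im z) (complex.Im c).
move=> x y s t; have := sqr_ge0 (x - y); have := sqr_ge0 (s - t).
have := sqr_ge0 (x + y); have := sqr_ge0 (s + t).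
by rewrite ler_norml; nra.
Qed.

Lemma Im_mul_conj_le z c : `|complex.Im (z^*%C * c)| <= sqmod z + sqmod c.
Proof.
rewrite complexImM complexReJ complexImJ /sqmod.
move: (complex.Re z) (complex.Re c) (complex.Im z) (complex.Im c).
move=> x y s t; have := sqr_ge0 (x - t); have := sqr_ge0 (s - y).
have := sqr_ge0 (x + t); have := sqr_ge0 (s + y).
by rewrite ler_norml; nra.
Qed.

(** * The Hermitian product on square-integrable functions *)

Definition sqint f :=
  cmeasurable f /\ sigma.-integrable setT (EFin \o (@sqmod \o f)).

Definition sqnorm f : R := \int[sigma]_x sqmod (f x).

Definition sprod f g : C := cintegral setT (fun x => (f x)^*%C * g x).

Lemma measurable_sqmod f : cmeasurable f -> measurable_fun setT (@sqmod \o f).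
Proof.
by move=> [mr mi]; apply: measurable_funD; apply: (@measurable_funX _ _ _ _ _ 2).
Qed.

Let dominated (F : T -> R) (B : T -> R) : measurable_fun setT F ->
  sigma.-integrable setT (EFin \o B) -> (forall x, `|F x| <= B x) ->
  sigma.-integrable setT (EFin \o F).
Proof.
move=> mF iB FB; apply: (le_integrable measurableT _ _ iB).
  exact/measurable_EFinP.
by move=> x _ /=; rewrite lee_fin (le_trans (FB x))// ler_norm.
Qed.

Let integrable_lin (F G : T -> R) (a b : R) :
  sigma.-integrable setT (EFin \o F) -> sigma.-integrable setT (EFin \o G) ->
  sigma.-integrable setT (EFin \o (fun x => a * F x + b * G x)).
Proof.
move=> iF iG.
have := integrableD measurableT (integrableZl measurableT a iF)
  (integrableZl measurableT b iG).
by apply: eq_integrable.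
Qed.

Lemma sqint_dominated f (a b : R) (h1 h2 : T -> C) : cmeasurable f ->
  sqint h1 -> sqint h2 ->
  (forall x, sqmod (f x) <= a * sqmod (h1 x) + b * sqmod (h2 x)) -> sqint f.
Proof.
move=> mf [m1 i1] [m2 i2] le; split => //.
apply: (dominated _ (integrable_lin a b i1 i2)); first exact: measurable_sqmod.
by move=> x /=; rewrite ger0_norm ?sqmod_ge0.
Qed.

Lemma sqintD f g : sqint f -> sqint g -> sqint (fun x => f x + g x).
Proof.
move=> sf sg; apply: (@sqint_dominated _ 2 2 f g) => //; last first.
  by move=> x; exact: sqmodD.
have [[rf imf] _] := sf; have [[rg img] _] := sg; split.
  rewrite (_ : _ \o _ = (@complex.Re R \o f) \+ (@complex.Re R \o g)).
    exact: measurable_funD.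
  by apply/funext => x /=; rewrite raddfD.
rewrite (_ : _ \o _ = (@complex.Im R \o f) \+ (@complex.Im R \o g)).
  exact: measurable_funD.
by apply/funext => x /=; rewrite raddfD.
Qed.

Lemma sqintZ c f : sqint f -> sqint (fun x => c * f x).
Proof.
move=> sf; apply: (@sqint_dominated _ (sqmod c) 0 f f) => //.
  by apply: cmeasurableM; [exact: cmeasurable_cst|have [] := sf].
by move=> x; rewrite sqmodM mul0r addr0.
Qed.

Lemma sqint_sum (I : Type) (r : seq I) (c : I -> C) (u : I -> T -> C) :
  (forall i, sqint (u i)) -> sqint (fun x => \sum_(i <- r) c i * u i x).
Proof.
move=> su; elim: r => [|i r IH].
  under eq_fun do rewrite big_nil.
  split; first exact: cmeasurable_cst.
  rewrite (_ : _ \o _ = cst 0%E); first exact: integrable0.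
  by apply/funext => x; rewrite /= /sqmod /= expr0n addr0.
under eq_fun do rewrite big_cons.
by apply: sqintD => //; exact: sqintZ.
Qed.

Lemma sqint_restrict f (D : set T) : measurable D -> sqint f -> sqint (patch (fun=> 0) D f).
Proof.
move=> mD sf; apply: (@sqint_dominated _ 1 0 f f) => //.
  have [[rf imf] _] := sf; split.
    rewrite (_ : _ \o _ = (@complex.Re R \o f) \_ D).
      by apply/(measurable_restrictT _ mD)/measurable_funTS.
    by apply/funext => x; rewrite /= /patch; case: ifP.
  rewrite (_ : _ \o _ = (@complex.Im R \o f) \_ D).
    by apply/(measurable_restrictT _ mD)/measurable_funTS.
  by apply/funext => x; rewrite /= /patch; case: ifP.
move=> x; rewrite /patch mul0r addr0 mul1r; case: ifP => // _.
by rewrite (le_trans _ (sqmod_ge0 _))// /sqmod /= expr0n addr0.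
Qed.

Lemma sqnorm_restrict f (D : set T) : measurable D -> sqint f ->
  sqnorm (patch (fun=> 0) D f) <= sqnorm f.
Proof.
move=> mD sf; apply: le_Rintegral => //.
- by have [] := sqint_restrict mD sf.
- by have [] := sf.
move=> x _; rewrite /patch; case: ifP => // _.
by rewrite (le_trans _ (sqmod_ge0 _))// /sqmod /= expr0n addr0.
Qed.

Lemma sqnorm_ge0 f : 0 <= sqnorm f.
Proof. by apply: Rintegral_ge0 => x _; exact: sqmod_ge0. Qed.

Let prod_int f g : sqint f -> sqint g ->
  sigma.-integrable setT (EFin \o (fun x => complex.Re ((f x)^*%C * g x))) /\
  sigma.-integrable setT (EFin \o (fun x => complex.Im ((f x)^*%C * g x))).
Proof.
move=> [mf jf] [mg jg].
have [mRe mIm] : cmeasurable (fun x => (f x)^*%C * g x).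
  by apply: cmeasurableM => //; exact: cmeasurable_conj.
have jfg := integrable_lin 1 1 jf jg.
split; apply: (dominated _ jfg) => // x; rewrite /= !mul1r.
- exact: Re_mul_conj_le.
- exact: Im_mul_conj_le.
Qed.

Lemma sprodDr f g h : sqint f -> sqint g -> sqint h ->
  sprod f (fun x => g x + h x) = sprod f g + sprod f h.
Proof.
move=> sf sg sh; have [a b] := prod_int sf sg; have [c d] := prod_int sf sh.
apply/eqP; rewrite eq_complex /sprod /cintegral /=; apply/andP; split; apply/eqP.
  by rewrite -RintegralD//; apply: eq_Rintegral => x _; rewrite mulrDr raddfD.
by rewrite -RintegralD//; apply: eq_Rintegral => x _; rewrite mulrDr raddfD.
Qed.

Lemma sprodZr f g z : sqint f -> sqint g ->
  sprod f (fun x => z * g x) = z * sprod f g.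
Proof.
move=> sf sg; have [a b] := prod_int sf sg.
(* Multiplication by [z] mixes real and imaginary parts, so linearity is needed for real
   combinations of two integrals. *)
have lin (F G : T -> R) p q : sigma.-integrable setT (EFin \o F) ->
    sigma.-integrable setT (EFin \o G) ->
    \int[sigma]_x (p * F x + q * G x) = p * \int[sigma]_x F x + q * \int[sigma]_x G x.
  move=> iF iG; rewrite RintegralD//; last 2 first.
  - by have := integrableZl measurableT p iF; apply: eq_integrable.
  - by have := integrableZl measurableT q iG; apply: eq_integrable.
  by rewrite !RintegralZl.
apply/eqP; rewrite eq_complex complexReM complexImM /sprod /cintegral /=.
rewrite -mulNr -!lin//; apply/andP; split; apply/eqP; apply: eq_Rintegral => x _.
  by rewrite mulrCA complexReM mulNr.
by rewrite mulrCA complexImM.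
Qed.

Lemma sprodC f g : sqint f -> sqint g -> sprod g f = (sprod f g)^*%C.
Proof.
move=> sf sg; have [a b] := prod_int sf sg.
apply/eqP; rewrite eq_complex complexReJ complexImJ /sprod /cintegral /=.
apply/andP; split; apply/eqP.
  by apply: eq_Rintegral => x _; rewrite !complexReM !complexReJ !complexImJ; ring.
rewrite -mulN1r -RintegralZl//.
by apply: eq_Rintegral => x _; rewrite !complexImM !complexReJ !complexImJ; ring.
Qed.

Lemma sprod_sqnorm f : sprod f f = real_complex R (sqnorm f).
Proof.
apply/eqP; rewrite eq_complex /sprod /cintegral /sqnorm /=.
apply/andP; split; apply/eqP.
  by apply: eq_Rintegral => x _; rewrite conjM_sqmod.
under eq_Rintegral do rewrite conjM_sqmod /=.
by rewrite Rintegral_cst// mul0r.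
Qed.

Lemma sprod_sumr (I : Type) (r : seq I) (c : I -> C) (u : I -> T -> C) f :
  sqint f -> (forall i, sqint (u i)) ->
  sprod f (fun x => \sum_(i <- r) c i * u i x) =
  \sum_(i <- r) c i * sprod f (u i).
Proof.
move=> sf su; elim: r => [|i r IH].
  under [X in sprod _ X]eq_fun do rewrite big_nil.
  (* The zero function is read as [0 * f], which makes the empty case an instance of homogeneity. *)
  rewrite big_nil -[RHS](mul0r (sprod f f)) -sprodZr//.
  by under [in RHS]eq_fun do rewrite mul0r.
under [X in sprod _ X]eq_fun do rewrite big_cons.
rewrite big_cons -IH sprodDr//; last 2 first.
- exact: sqintZ.
- exact: sqint_sum.
by rewrite sprodZr.
Qed.

(** * Finite orthonormal families *)

Section Orthonormal.
Variables (I : finType) (u : I -> T -> C).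
Hypothesis su : forall i, sqint (u i).
Hypothesis ou : forall i j, sprod (u i) (u j) = (i == j)%:R.

Lemma sprod_orthonormal_sum (i : I) (a : I -> C) :
  sprod (u i) (fun x => \sum_j a j * u j x) = a i.
Proof.
rewrite sprod_sumr// (bigD1 i)//= ou eqxx mulr1 big1 ?addr0// => j ji.
by rewrite ou eq_sym (negbTE ji) mulr0.
Qed.

Lemma sprod_sum_conj f (a : I -> C) : sqint f ->
  (forall i, sprod (u i) f = a i) ->
  sprod f (fun x => \sum_j a j * u j x) = real_complex R (\sum_j sqmod (a j)).
Proof.
move=> sf fa; rewrite sprod_sumr// rmorph_sum; apply: eq_bigr => i _.
by rewrite (@sprodC (u i) f)// fa mulrC conjM_sqmod.
Qed.

Lemma sqnorm_orthonormal_sum (a : I -> C) :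
  sqnorm (fun x => \sum_j a j * u j x) = \sum_j sqmod (a j).
Proof.
have sS : sqint (fun x => \sum_j a j * u j x) by exact: sqint_sum.
have := sprod_sqnorm (fun x => \sum_j a j * u j x).
rewrite (@sprod_sum_conj _ a)//; first by case.
by move=> i; exact: sprod_orthonormal_sum.
Qed.

(** With [s] the projection of [f] on the span, the remainder [g = f - s] is orthogonal to [s].
    Hence its squared norm is [sqnorm f - S], which is nonnegative. *)
Lemma bessel f : sqint f -> \sum_i sqmod (sprod (u i) f) <= sqnorm f.
Proof.
move=> sf; pose a i := sprod (u i) f; pose s x := \sum_j a j * u j x.
pose S := \sum_i sqmod (a i).
have ss : sqint s by exact: sqint_sum.
pose g x := f x + (-1) * s x.
have sNs : sqint (fun x => -1 * s x) by exact: sqintZ.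
have sg : sqint g by exact: sqintD.
have fs : sprod f s = real_complex R S by exact: sprod_sum_conj.
have ssE : sprod s s = real_complex R S.
  by rewrite sprod_sqnorm /s sqnorm_orthonormal_sum.
have sfE : sprod s f = real_complex R S.
  by rewrite (@sprodC f s)// fs; apply/eqP; rewrite eq_complex /= oppr0 !eqxx.
have sg0 : sprod s g = 0 by rewrite sprodDr// sprodZr// sfE ssE mulN1r subrr.
have fgE : sprod f g = real_complex R (sqnorm f - S).
  by rewrite sprodDr// sprodZr// fs sprod_sqnorm rmorphB mulN1r.
have ggE : sprod g g = real_complex R (sqnorm f - S).
  rewrite {2}/g sprodDr// sprodZr// (@sprodC f g)// (@sprodC s g)// sg0 fgE.
  by apply/eqP; rewrite eq_complex /= !(mulr0, mul0r, subr0, oppr0, addr0, mulN1r) !eqxx.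
have := sqnorm_ge0 g; move: ggE; rewrite sprod_sqnorm => -[->].
by rewrite subr_ge0.
Qed.

End Orthonormal.

End SphereL2.

(** * Boundedness of the matrix Y *)

Section Sequences.
Variable R : realType.

Lemma cvgn_sum (I : Type) (r : seq I) (F : I -> nat -> R) (L : I -> R) :
  (forall i, F i n @[n --> \oo] --> L i) ->
  \sum_(i <- r) F i n @[n --> \oo] --> \sum_(i <- r) L i.
Proof.
move=> FL; elim: r => [|i r IH].
  by under eq_fun do rewrite big_nil; rewrite big_nil; exact: cvg_cst.
under eq_fun do rewrite big_cons; rewrite big_cons.
by apply: cvgD; [exact: FL|exact: IH].
Qed.

(** Absolute convergence: the partial sums of the moduli are nondecreasing and bounded. *)
Lemma cvg_series_bounded (u : nat -> R) (M : R) :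
  (forall n, \sum_(k < n) `|u k| <= M) -> cvgn (series u).
Proof.
move=> uM; apply: normed_cvg; apply: nondecreasing_is_cvgn.
  apply: nondecreasing_series => k _ _; exact: normr_ge0.
by exists M => _ [n _ <-]; have := uM n; rewrite -(big_mkord xpredT (fun k => `|u k|)).
Qed.

End Sequences.

(** * Euclidean norm of a block and the l2 norm *)

Section NormTwo.
Variable R : realType.
Local Notation C := R[i].

Lemma norm2_ge0 n (v : 'cV[C]_n) : 0 <= norm2 v.
Proof. exact: sqrtr_ge0. Qed.

Lemma sqr_norm2 n (v : 'cV[C]_n) : norm2 v ^+ 2 = \sum_i sqmod (v i 0).
Proof.
rewrite sqr_sqrtr; last by apply: sumr_ge0 => i _; exact: sqr_ge0.
by apply: eq_bigr => i _; exact: normc_sqmod.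
Qed.

Lemma norm2Z (r : R) n (v : 'cV[C]_n) :
  norm2 (real_complex R r *: v) = `|r| * norm2 v.
Proof.
apply/eqP; rewrite -(@eqrXn2 _ 2) ?mulr_ge0 ?norm2_ge0//; apply/eqP.
rewrite exprMn !sqr_norm2 mulr_sumr; apply: eq_bigr => i _.
by rewrite mxE sqmodM {1}/sqmod /= expr0n addr0 real_normK ?num_real.
Qed.

Lemma norm2N n (v : 'cV[C]_n) : norm2 (- v) = norm2 v.
Proof.
by rewrite -scaleN1r (_ : -1 = real_complex R (-1)) ?norm2Z ?normrN1 ?mul1r ?rmorphN1.
Qed.

Lemma norm2_eq0 n (v : 'cV[C]_n) : (norm2 v == 0) = (v == 0).
Proof.
apply/idP/eqP => [/eqP v0|->]; last first.
  by rewrite -[0](scale0r (0 : 'cV_n)) -[0](rmorph0 (real_complex R)) norm2Z normr0 mul0r.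
have := sqr_norm2 v; rewrite v0 expr0n => /esym/eqP.
rewrite psumr_eq0 => [/allP v00|i _]; last exact: sqmod_ge0.
apply/matrixP => i j; rewrite (ord1 j) mxE; apply/eqP; rewrite eq_complex /=.
have := v00 i (mem_index_enum _); rewrite /sqmod paddr_eq0 ?sqr_ge0//.
by rewrite !sqrf_eq0.
Qed.

Lemma sqr_norm2B n (v w : 'cV[C]_n) :
  norm2 (v - w) ^+ 2 <= 2 * norm2 v ^+ 2 + 2 * norm2 w ^+ 2.
Proof.
rewrite !sqr_norm2 !mulr_sumr -big_split; apply: ler_sum => i _.
by rewrite !mxE; exact: sqmodB.
Qed.

(** Turns finiteness of the extended real norm into a uniform real bound on partial sums, the form
    in which square summability is used below. *)
Lemma l2norm_lty (v : coeffs R) : (l2norm v < +oo)%E ->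
  exists M : R, forall n, \sum_(l < n) norm2 (v l) ^+ 2 <= M.
Proof.
move=> /lty_poweRy; rewrite invr_neq0// => /(_ isT).
set S := (\sum_(_ <= _ <oo) _)%E => Soo.
have nn l : (0 <= l)%N -> true -> (0 <= (norm2 (v l) ^+ 2)%:E)%E.
  by rewrite lee_fin sqr_ge0.
have S0 : (0 <= S)%E by apply: nneseries_ge0.
have Sfin : S \is a fin_num by rewrite ge0_fin_numE.
exists (fine S) => n; rewrite -lee_fin fineK// -sumEFin.
by have := @nneseries_lim_ge _ _ xpredT 0 n nn; rewrite big_mkord.
Qed.

Lemma l2norm_le (v : coeffs R) (M : R) :
  (forall n, \sum_(l < n) norm2 (v l) ^+ 2 <= M) ->
  (l2norm v <= (Num.sqrt M)%:E)%E.
Proof.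
move=> vM; have M0 : 0 <= M by have := vM 0; rewrite big_ord0.
have nn l : (0 <= l)%N -> true -> (0 <= (norm2 (v l) ^+ 2)%:E)%E.
  by rewrite lee_fin sqr_ge0.
rewrite -powR12_sqrt// -poweR_EFin /l2norm.
apply: gt0_ler_poweR => //.
- by rewrite in_itv/= leey nneseries_ge0.
- by rewrite in_itv/= leey lee_fin M0.
apply: lime_le; first exact: is_cvg_nneseries.
by apply: nearW => n; rewrite big_mkord sumEFin lee_fin.
Qed.

End NormTwo.

(** * Fourier coefficients, partial expansions and restriction to [Gamma] *)

Section HarmonicExpansion.
Variable R : realType.
Local Notation C := R[i].
Local Notation T := (R * R * R)%type.

Definition harm (l : nat) (i : 'I_(l.*2.+1)) : T -> C := @sph_harm R l (harm_order i).

Definition fourier (f : T -> C) : coeffs R := fun l => \col_i sprod (harm i) f.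

Definition synthesis (a : coeffs R) (n : nat) : T -> C :=
  fun x => \sum_(l < n) \sum_i a l i 0 * harm i x.

Lemma harm_order_le l (i : 'I_(l.*2.+1)) : (`|harm_order i| <= l)%N.
Proof. by have := ltn_ord i; rewrite /harm_order; lia. Qed.

Lemma sqint_harm l (i : 'I_(l.*2.+1)) : sqint (harm i).
Proof.
split; first exact: cmeasurable_sph_harm.
have [+ _] := @integrable_sph_harm_kernel R l l (harm_order i) (harm_order i).
by apply: eq_integrable => // x _; rewrite /= conjM_sqmod.
Qed.

Section Truncated.
Variable n : nat.

(** Degree and order are merged into one finite index, so that the results on finite orthonormal
    families apply to all degrees below [n] at once. *)
Let idx : finType := {l : 'I_n & 'I_(l.*2.+1)}.
Let hrm (k : idx) : T -> C := harm (tagged k).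

Let hrm_sqint k : sqint (hrm k). Proof. exact: sqint_harm. Qed.

Let hrm_orthonormal k k' : sprod (hrm k) (hrm k') = (k == k')%:R.
Proof.
case: k k' => [l i] [l' i'].
rewrite /sprod /hrm /harm sph_harm_orthonormal ?harm_order_le//=; congr (_%:R).
congr nat_of_bool; rewrite -[RHS]/(tag_eq _ _) /tag_eq /= val_eqE.
have [ll'|//] := eqVneq l l'; move: i'; rewrite -ll' => i'.
rewrite tagged_asE; apply/eqP/eqP => [|->//].
by rewrite /harm_order => /addIr[] /val_inj.
Qed.

Lemma bessel_harm f : sqint f ->
  \sum_(l < n) norm2 (fourier f l) ^+ 2 <= sqnorm f.
Proof.
move=> sf; under eq_bigr do rewrite sqr_norm2.
rewrite sig_big_dep; apply: le_trans (bessel hrm_sqint hrm_orthonormal sf).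
by rewrite le_eqVlt; apply/orP; left; apply/eqP; apply: eq_bigr => k _; rewrite mxE.
Qed.

Lemma synthesisE a x : synthesis a n x =
  \sum_(k : idx) a (tag k) (tagged k) 0 * hrm k x.
Proof. by rewrite /synthesis sig_big_dep. Qed.

Lemma sqint_synthesis a : sqint (synthesis a n).
Proof.
have := @sqint_sum R idx (index_enum idx) (fun k : idx => a (tag k) (tagged k) 0) hrm hrm_sqint.
by under eq_fun do rewrite -synthesisE.
Qed.

Lemma sqnorm_synthesis a :
  sqnorm (synthesis a n) = \sum_(l < n) norm2 (a l) ^+ 2.
Proof.
under [RHS]eq_bigr do rewrite sqr_norm2.
rewrite sig_big_dep -(sqnorm_orthonormal_sum hrm_sqint hrm_orthonormal).
by congr sqnorm; apply/funext => x; rewrite synthesisE.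
Qed.

End Truncated.

Section Patch.
Variable Gamma : set T.
Hypothesis mGamma : measurable Gamma.
Local Notation cut := (patch (fun=> 0) Gamma).

Lemma cintegral_sprod_cut (f g : T -> C) :
  cintegral Gamma (fun x => (f x)^*%C * g x) = sprod f (cut g).
Proof.
rewrite /sprod /cintegral !(Rintegral_mkcond _ Gamma).
by congr Complex; apply: eq_Rintegral => x _; rewrite /patch; case: ifP => //;
  rewrite mulr0.
Qed.

(** Multiplication by the indicator of [Gamma] is self-adjoint; Y is its matrix with respect to the
    spherical harmonics. *)
Lemma sprod_cutC (f g : T -> C) : sprod f (cut g) = sprod (cut f) g.
Proof.
rewrite /sprod; congr cintegral; apply/funext => x.
by rewrite /patch; case: ifP => //; rewrite mulr0 conjc0 mul0r.
Qed.

Lemma Yblock_sprod l l' i j :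
  Yblock Gamma l l' i j = sprod (harm i) (cut (harm j)).
Proof. by rewrite mxE cintegral_sprod_cut. Qed.

Lemma alpha0_fourier (T0 : T -> R) :
  alpha0 Gamma T0 = fourier (cut (fun x => real_complex R (T0 x))).
Proof.
apply: functional_extensionality_dep => l; apply/matrixP => i j.
rewrite !mxE -cintegral_sprod_cut; congr cintegral.
by apply/funext => x; rewrite mulrC.
Qed.

(** Truncating the column sum of Y a at [n] amounts to cutting off the partial expansion of [a].
    This brings Bessel's inequality to bear on Y a. *)
Lemma Yblock_synthesis (a : coeffs R) l (i : 'I_(l.*2.+1)) n :
  \sum_(l' < n) (Yblock Gamma l l' *m a l') i 0 =
  fourier (cut (synthesis a n)) l i 0.
Proof.
rewrite [RHS]mxE sprod_cutC.
pose hrm (k : {l' : 'I_n & 'I_(l'.*2.+1)}) : T -> C := harm (tagged k).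
have -> : synthesis a n = fun x => \sum_(k : {l' : 'I_n & 'I_(l'.*2.+1)})
      a (tag k) (tagged k) 0 * hrm k x.
  by apply/funext => x; rewrite synthesisE.
rewrite sprod_sumr; last 2 first.
- exact/sqint_restrict/sqint_harm.
- by move=> k; exact: sqint_harm.
rewrite -(@sig_big_dep _ _ _ 'I_n (fun l' => 'I_(l'.*2.+1)) xpredT (fun _ => xpredT)
  (fun l' j => a l' j 0 * sprod (cut (harm i)) (harm j))).
apply: eq_bigr => l' _; rewrite mxE; apply: eq_bigr => j _.
by rewrite Yblock_sprod -sprod_cutC mulrC.
Qed.

Variable a : coeffs R.
Variable M : R.
Hypothesis aM : forall n, \sum_(l < n) norm2 (a l) ^+ 2 <= M.

Let term l (i : 'I_(l.*2.+1)) (l' : nat) : C := (Yblock Gamma l l' *m a l') i 0.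

(** Up to conjugation, row (l, i) of Y lists the Fourier coefficients of the cut harmonic. Young's
    inequality then bounds each term by two summable quantities; [P] stands for the real or the
    imaginary part. *)
Let term_le l (i : 'I_(l.*2.+1)) l' (P : C -> R) :
  {morph P : x y / x + y} -> P 0 = 0 ->
  (forall z c, `|P (z * c)| <= sqmod z + sqmod c) ->
  `|P (term i l')| <= norm2 (fourier (cut (harm i)) l') ^+ 2 + norm2 (a l') ^+ 2.
Proof.
move=> PD P0 Ple; rewrite /term mxE (big_morph P PD P0) (le_trans (ler_norm_sum _ _ _))//.
rewrite !sqr_norm2 -big_split; apply: ler_sum => j _.
rewrite (le_trans (Ple _ _))// lerD2r Yblock_sprod sprod_cutC mxE.
rewrite (@sprodC _ (harm j)) ?sqmod_conj//; first exact: sqint_harm.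
exact/sqint_restrict/sqint_harm.
Qed.

Let cvg_part l (i : 'I_(l.*2.+1)) (P : C -> R) :
  {morph P : x y / x + y} -> P 0 = 0 ->
  (forall z c, `|P (z * c)| <= sqmod z + sqmod c) ->
  cvgn (series (fun l' => P (term i l'))).
Proof.
move=> PD P0 Ple; apply: (@cvg_series_bounded _ _ (sqnorm (cut (harm i)) + M)) => n.
rewrite (le_trans (ler_sum _ (fun l' _ => term_le _ _ PD P0 Ple)))//.
rewrite big_split lerD//; apply: bessel_harm.
exact/sqint_restrict/sqint_harm.
Qed.

(** Y does not increase the l2 norm: for each truncation this follows from Bessel, from restriction
    decreasing the norm and from Parseval for finite sums. *)
Lemma sum_norm2_Ymul_le N : \sum_(l < N) norm2 (Ymul Gamma a l) ^+ 2 <= M.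
Proof.
have ReLe (z c : C) : `|complex.Re (z * c)| <= sqmod z + sqmod c.
  by have := Re_mul_conj_le z^*%C c; rewrite conjcK sqmod_conj.
have ImLe (z c : C) : `|complex.Im (z * c)| <= sqmod z + sqmod c.
  by have := Im_mul_conj_le z^*%C c; rewrite conjcK sqmod_conj.
have ReD : {morph @complex.Re R : x y / x + y} by move=> x y; rewrite raddfD.
have ImD : {morph @complex.Im R : x y / x + y} by move=> x y; rewrite raddfD.
pose S n := \sum_(l < N) norm2 (fourier (cut (synthesis a n)) l) ^+ 2.
have SM n : S n <= M.
  rewrite /S (le_trans (bessel_harm _ _))//.
    exact/sqint_restrict/sqint_synthesis.
  rewrite (le_trans (sqnorm_restrict _ _))//; first exact: sqint_synthesis.
  by rewrite sqnorm_synthesis.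
(* With the number [N] of blocks fixed, only finitely many entries are involved, so entrywise
   convergence in [n] suffices to carry the bound to the limit. *)
have Scvg : S n @[n --> \oo] --> \sum_(l < N) norm2 (Ymul Gamma a l) ^+ 2.
  apply: cvgn_sum => l; rewrite sqr_norm2.
  under eq_fun do rewrite sqr_norm2.
  apply: cvgn_sum => i; rewrite [Ymul _ _ _ _ _]mxE /cseries /sqmod /=.
  have part (P : C -> R) : {morph P : x y / x + y} -> P 0 = 0 ->
      (forall z c, `|P (z * c)| <= sqmod z + sqmod c) ->
      P (fourier (cut (synthesis a n)) l i 0) @[n --> \oo] -->
      limn (series (fun l' => P (term i l'))).
    move=> PD P0 Ple; have := @cvg_part l i P PD P0 Ple; apply: cvg_trans.
    apply: near_eq_cvg; apply: nearW => n.
    by rewrite /series /= big_mkord -Yblock_synthesis (big_morph P PD P0).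
  rewrite !expr2; under eq_fun do rewrite !expr2.
  by apply: cvgD; apply: cvgM; apply: part.
rewrite -(cvg_lim _ Scvg)//; apply: limr_le; first by apply/cvg_ex; eexists; exact: Scvg.
exact: nearW.
Qed.

End Patch.

End HarmonicExpansion.

(** * Lower bound on the nonzero blocks *)

Section Residual.
Variable R : realType.

Lemma sqint_Lfun2 (f : R * R * R -> R) :
  f \in Lfun (surface_measure R) 2%:E -> sqint (fun x => real_complex R (f x)).
Proof.
move=> f2; have := f2; rewrite inE => /andP[mf _]; split.
  by apply: cmeasurable_real; move: mf; rewrite inE.
have := Lfun2_integrable_sqr f2; apply: eq_integrable => // x _.
by rewrite /= /sqmod /= expr0n addr0.
Qed.

Lemma residual_bound (Gamma : set (R * R * R)) (T0 : R * R * R -> R) (a : coeffs R) :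
  measurable Gamma -> T0 \in Lfun (surface_measure R) 2%:E ->
  (l2norm a < +oo)%E ->
  exists M : R, forall n, \sum_(l < n) norm2 (residual Gamma T0 a l) ^+ 2 <= M.
Proof.
move=> mG T2 /l2norm_lty[M aM].
have sT := sqint_restrict mG (sqint_Lfun2 T2).
(* The two summands account for Y a and for [alpha0]; the factors 2 come from [sqr_norm2B]. *)
exists (2 * M + 2 * sqnorm (patch (fun=> 0) Gamma (fun x => real_complex R (T0 x)))) => n.
rewrite (le_trans (ler_sum _ (fun l _ => sqr_norm2B _ _)))//.
rewrite big_split -!mulr_sumr lerD// ler_pM2l//.
  exact: sum_norm2_Ymul_le.
by rewrite alpha0_fourier; exact: bessel_harm.
Qed.

Lemma beta_ge1 (p eta : R) l : 0 <= p -> 1 <= eta -> 1 <= beta p eta l.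
Proof.
move=> p0 eta1; rewrite /beta; case: eqVneq => // l0.
rewrite mulr_ege1 ?exprn_ege1//.
by rewrite -[leLHS](powRr0 l%:R) ler_powR// ler1n lt0n.
Qed.

(* Here [x] and [r] are the norms of the blocks of degree [l] of the KKT point
   and of its residual. *)
Lemma stationary_lower_bound (p b nu c x r : R) :
  0 < p < 1 -> 0 < b -> 0 <= nu -> 0 < c -> 0 < x -> r <= c ->
  p * b * x `^ p * x = 2 * nu * x ^+ 2 * r ->
  0 < nu /\ (p * b / (2 * nu * c)) `^ (1 / (1 - p)) <= x.
Proof.
move=> /andP[p0 p1] b0 nu0 c0 x0 rc E.
have xp0 : 0 < x `^ p by exact: powR_gt0.
have L0 : 0 < p * b * x `^ p * x by rewrite !mulr_gt0.
(* With [nu = 0] the right side of the stationarity equation would vanish, whereas its left side is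
   positive. *)
have nu_gt0 : 0 < nu.
  rewrite lt_neqAle nu0 andbT; apply/eqP => nuE.
  by move: L0; rewrite E -nuE mulr0 !mul0r ltxx.
split=> //; have q0 : 0 < 1 - p by rewrite subr_gt0.
have xE : x `^ (1 - p) * x `^ p = x.
  rewrite -powRD ?subrK ?powRr1 ?(ltW x0)//.
  by rewrite (gt_eqF x0) implybT.
have le : p * b / (2 * nu * c) <= x `^ (1 - p).
  rewrite ler_pdivrMr ?mulr_gt0//.
  rewrite -(ler_pM2r (mulr_gt0 xp0 x0)).
  rewrite [leLHS]mulrA E.
  rewrite [leRHS](_ : _ = 2 * nu * x ^+ 2 * c).
    by rewrite ler_pM2l// !mulr_gt0 ?exprn_gt0.
  rewrite [LHS](_ : _ = x `^ (1 - p) * x `^ p * x * (2 * nu * c)); last by ring.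
  by rewrite xE; ring.
rewrite -[leRHS]powRr1 ?(ltW x0)// -[in leRHS](divff (lt0r_neq0 q0)).
rewrite [leRHS]powRrM div1r ge0_ler_powR ?invr_ge0 ?nnegrE ?powR_ge0 ?(ltW q0)//.
by rewrite divr_ge0 ?mulr_ge0 ?(ltW p0) ?(ltW b0) ?(ltW c0).
Qed.

End Residual.

Theorem mainTheorem1 (R : realType) (p eta : R)
    (Gamma : set (R * R * R)) (T0 : R * R * R -> R) (rho : R)
    (a : coeffs R) (nu : R)
    (hp : 0 < p < 1) (heta : 1 < eta)
    (mGamma : measurable Gamma)
    (Gamma_sphere : Gamma `<=` sphere R)
    (Gamma_open : exists U : set (R * R * R), [/\ open U,
       U `&` sphere R !=set0 & U `&` sphere R `<=` Gamma])
    (Gamma_compl : (sphere R `\` Gamma) !=set0)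
    (hT0 : T0 \in Lfun (surface_measure R) 2%:E)
    (hrho : energy T0 (sphere R `\` Gamma) < rho < energy T0 (sphere R))
    (ha : in_lpbeta p eta a)
    (hKKT : scaled_KKT p eta Gamma T0 rho a nu) :
  (exists ctilde : R, [/\ 0 < ctilde,
     (l2norm (residual Gamma T0 a) <= ctilde%:E)%E &
     forall l : nat, a l != 0 ->
       0 < nu /\
       (p * beta p eta l / (2 * nu * ctilde)) `^ (1 / (1 - p)) <= norm2 (a l)])
  /\ finite_set [set l : nat | norm2 (a l) != 0].
Proof.
have [M resM] := residual_bound mGamma hT0 ha.1.
have M0 : 0 <= M by have := resM 0; rewrite big_ord0.
(* Adding 1 keeps the constant positive even if the residual vanishes. *)
pose ct := Num.sqrt M + 1.
have ct0 : 0 < ct by rewrite ltr_wpDl ?sqrtr_ge0.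
have res_le l : norm2 (residual Gamma T0 a l) <= ct.
  rewrite (@le_trans _ _ (Num.sqrt M))//; last by rewrite lerDl.
  rewrite -(ger0_norm (norm2_ge0 _)) -sqrtr_sqr ler_sqrt//.
  rewrite (le_trans _ (resM l.+1))// big_ord_recr /= lerDr.
  by apply: sumr_ge0 => i _; exact: sqr_ge0.
have [/andP[p0 p1] eta1] := (hp, ltW heta).
have b1 l : 1 <= beta p eta l by apply: beta_ge1 => //; exact: ltW.
have nu_ge0 := kkt_multiplier hKKT.
have lower l : a l != 0 -> 0 < nu /\
    (p * beta p eta l / (2 * nu * ct)) `^ (1 / (1 - p)) <= norm2 (a l).
  move=> al0; have x0 : 0 < norm2 (a l).
    by rewrite lt_neqAle norm2_ge0 eq_sym norm2_eq0 al0.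
  apply: (@stationary_lower_bound _ _ _ _ _ _ (norm2 (residual Gamma T0 a l))) => //.
  - exact: lt_le_trans (b1 l).
  (* Moving one term across and taking norms gives the scalar equation; both real coefficients are
     nonnegative, so no absolute values remain. *)
  have /eqP := kkt_stationary hKKT l; rewrite addr_eq0 => /eqP/(congr1 (@norm2 R _)).
  rewrite norm2N !norm2Z !ger0_norm//.
  - by rewrite !mulr_ge0 ?norm2_ge0.
  - by rewrite !mulr_ge0 ?powR_ge0 ?(ltW p0)// (le_trans ler01).
split.
  exists ct; split => //; rewrite (le_trans (l2norm_le resM))//.
  by rewrite lee_fin lerDl.
(* A nonzero block is needed to know [nu > 0]; without one the set is empty. *)
have [[l0 al0]|none] := pselect (exists l, a l != 0); last first.
  rewrite (_ : [set _ | _] = set0)//; apply/seteqP; split => // l /= al.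
  by apply: none; exists l; rewrite -norm2_eq0.
have [nu0 _] := lower _ al0.
(* The lower bound with [beta] replaced by its minimum 1, hence independent of the degree. *)
pose d := (p / (2 * nu * ct)) `^ (1 / (1 - p)).
have q0 : 0 < p / (2 * nu * ct) by rewrite divr_gt0 ?mulr_gt0.
have d0 : 0 < d by exact: powR_gt0.
have d_le l : norm2 (a l) != 0 -> d <= norm2 (a l).
  rewrite norm2_eq0 => /lower[_]; apply: le_trans.
  apply: ge0_ler_powR; rewrite ?nnegrE ?(ltW q0)//.
  - by rewrite divr_ge0// subr_ge0 ltW.
  - by rewrite divr_ge0 ?mulr_ge0 ?(ltW p0) ?(ltW nu0) ?(ltW ct0)// (le_trans ler01).
  - by rewrite ler_pM2r ?invr_gt0 ?mulr_gt0// ler_peMr ?(ltW p0).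
have [A aA] := l2norm_lty ha.1.
have : norm2 (a l) ^+ 2 @[l --> \oo] --> 0.
  apply: cvg_series_cvg_0; apply: (@cvg_series_bounded _ _ A) => n.
  by rewrite (le_trans _ (aA n))// ler_sum// => l _; rewrite ger0_norm ?sqr_ge0.
move=> /cvgrPdist_lt/(_ _ (exprn_gt0 2 d0))[N _ aN].
(* From [N] on the squared norms are below [d ^+ 2], which contradicts the lower bound [d], so every
   nonzero block has degree below [N]. *)
apply: (@sub_finite_set _ _ `I_N); last exact: finite_II.
move=> l /= /d_le dl; rewrite ltnNge; apply/negP => /aN /=.
rewrite sub0r normrN ger0_norm ?sqr_ge0// ltNge ler_pXn2r ?nnegrE ?norm2_ge0 ?(ltW d0)//.
by rewrite dl.
Qed.
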